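(* Let $N,q,p$ be positive integers with $\gcd(N,q)=\gcd(N,p)=1$. If $p$ and $q$ are mutually prime, then the knot $K(N,q,p)$ is ribbon.
   Context: For positive integers $N,q,p$ with $\gcd(N,q)=\gcd(N,p)=1$ and $\phi\in\mathbb{R}$, $K(N,q,p,\phi)$ is the closed curve in $\mathbb{R}^3$ given for $t\in[0,2\pi]$ by $x=(2+\sin(qt))\cos(Nt)$, $y=(2+\sin(qt))\sin(Nt)$, $z=\cos(p(t+\phi))$. The phase $\phi$ is critical if this curve is singular (not embedded). For non-critical $\phi$ the knot type does not depend on $\phi$ up to mirror image; it is denoted $K(N,q,p)$ (defined up to mirror image). A knot in $\mathbb{S}^3$ is ribbon if it bounds an immersed disk in $\mathbb{S}^3$ with only ribbon singularities; equivalently, it bounds an embedded disk in the ball $\mathbb{B}^4$ on which the distance to the origin has no local maximum (in the interior). *)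

(* Defs.v *)
From HB Require Import structures.
From mathcomp Require Import all_boot all_order all_algebra.
From mathcomp Require Import all_classical all_reals all_analysis.

Set Implicit Arguments.
Unset Strict Implicit.
Unset Printing Implicit Defensive.

Import Order.TTheory GRing.Theory Num.Theory.
Import numFieldNormedType.Exports.

Local Open Scope classical_set_scope.
Local Open Scope ring_scope.

(* The library norm on row vectors is the sup norm, so the Euclidean disk and
   spheres are defined through the sum of squares. *)
Definition sqnorm (R : realType) (n : nat) (x : 'rV[R]_n) : R :=
  \sum_(i < n) x 0 i ^+ 2.

Definition disk (R : realType) : set 'rV[R]_2 := [set x | sqnorm x <= 1].
Definition open_disk (R : realType) : set 'rV[R]_2 := [set x | sqnorm x < 1].
Definition circle (R : realType) : set 'rV[R]_2 := [set x | sqnorm x = 1].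
Definition sphere3 (R : realType) : set 'rV[R]_4 := [set x | sqnorm x = 1].

(* R^3 is seen as the 3-sphere minus the point (0, 0, 0, 1) through
   x |-> (2 x, |x|^2 - 1) / (|x|^2 + 1). *)
Definition inv_stereo (R : realType) (x : 'rV[R]_3) : 'rV[R]_4 :=
  (sqnorm x + 1)^-1 *: (row_mx (2 *: x) (sqnorm x - 1)%:M : 'rV[R]_(3 + 1)).

Fixpoint Ck (R : realType) (V W : normedModType R) (k : nat) (f : V -> W)
    : Prop :=
  match k with
  | 0 => continuous f
  | j.+1 => (forall x, differentiable f x) /\
            (forall v, Ck j (fun x => 'D_v f x))
  end.

Definition smooth (R : realType) (V W : normedModType R) (f : V -> W) : Prop :=
  forall k, Ck k f.

(* Smoothness on the closed disk means that the map is the restriction of a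
   smooth map of the plane, so maps of the disk are taken to be defined on the
   whole plane, and only their restriction to the disk is constrained otherwise.
   With row vectors, the differential at x is v |-> v *m 'J f x, so the tangent
   plane of the sheet of f through f x is the row space of 'J f x. *)
Definition disk_immersion (R : realType) (f : 'rV[R]_2 -> 'rV[R]_4) : Prop :=
  [/\ smooth f,
      f @` @disk R `<=` @sphere3 R &
      forall x, x \in @disk R -> \rank ('J f x) = 2%N].

(* The two preimages in the disk of the i-th arc of double points are a i,
   in the interior of the disk, and b i, properly embedded in the disk. They are
   parametrized on [0, 1] by the arc itself: f (a i s) = f (b i s). *)
Record ribbon_singularities (R : realType) (f : 'rV[R]_2 -> 'rV[R]_4) (n : nat)
    (a b : 'I_n -> R -> 'rV[R]_2) : Prop := RibbonSingularities {
  rs_continuous : forall i,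
    {within `[0, 1], continuous (a i)} /\ {within `[0, 1], continuous (b i)};
  rs_interior : forall i (s : R), s \in `[0, 1] -> @open_disk R (a i s);
  rs_proper_ends : forall i, @circle R (b i 0) /\ @circle R (b i 1);
  rs_proper : forall i (s : R), s \in `]0, 1[ -> @open_disk R (b i s);
  rs_inj_a : forall i j (s t : R), s \in `[0, 1] -> t \in `[0, 1] ->
    a i s = a j t -> i = j /\ s = t;
  rs_inj_b : forall i j (s t : R), s \in `[0, 1] -> t \in `[0, 1] ->
    b i s = b j t -> i = j /\ s = t;
  rs_disjoint : forall i j (s t : R), s \in `[0, 1] -> t \in `[0, 1] ->
    a i s <> b j t;
  rs_image : forall i (s : R), s \in `[0, 1] -> f (a i s) = f (b i s);
  rs_double : forall x y, x \in @disk R -> y \in @disk R ->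
    x <> y -> f x = f y ->
    exists i (s : R), s \in `[0, 1] /\
      ((x = a i s /\ y = b i s) \/ (x = b i s /\ y = a i s));
  rs_transverse : forall i (s : R), s \in `[0, 1] ->
    \rank ('J f (a i s) + 'J f (b i s))%MS = 3%N
}.

(* A map with only ribbon singularities is injective on the circle, since one of
   the two points of a double pair is interior. *)
Definition ribbon (R : realType) (K : set 'rV[R]_4) : Prop :=
  exists f : 'rV[R]_2 -> 'rV[R]_4,
    [/\ disk_immersion f,
        exists (n : nat) (a b : 'I_n -> R -> 'rV[R]_2),
          ribbon_singularities f a b &
        f @` @circle R = K].

Definition lissajous_toric (R : realType) (N q p : nat) (phi t : R)
    : 'rV[R]_3 :=
  \row_(i < 3) [:: (2 + sin (q%:R * t)) * cos (N%:R * t);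
                   (2 + sin (q%:R * t)) * sin (N%:R * t);
                   cos (p%:R * (t + phi))]`_i.

(* For smooth 2 pi-periodic curves. *)
Definition embedded_closed_curve (R : realType) (g : R -> 'rV[R]_3) : Prop :=
  {in `[0, 2 * pi[ &, injective g} /\ forall t, derive1 g t != 0.

Definition critical_phase (R : realType) (N q p : nat) (phi : R) : Prop :=
  ~ embedded_closed_curve (lissajous_toric N q p phi).

(* The knot type K(N, q, p), defined up to mirror image, is represented by this
   subset of the 3-sphere for any phi that is not critical. *)
Definition knotK (R : realType) (N q p : nat) (phi : R) : set 'rV[R]_4 :=
  (@inv_stereo R \o lissajous_toric N q p phi) @` `[0, 2 * pi].

(* Main.v *)
Require Import Defs.
From mathcomp Require Import all_boot all_order all_algebra.
From mathcomp Require Import all_classical all_reals all_analysis.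
From mathcomp Require Import zify ring lra.

(** The idea is to fill the knot by chords that join points at the same height.
    Shift the time by t1, chosen so that the height becomes cos(p v) up to sign.
    After a rotation about the z axis the knot has angle N v and radius
    2 + cos(q v + c), and for 0 <= v <= pi its points at v and at - v have the
    same height. Join them by a curve in that horizontal plane which crosses the
    plane y = 0. With X = cos v and Y proportional to the position on the curve,
    these curves become the chords X = constant of the unit disk, degenerate at
    the two ends. All the trigonometric functions become Chebyshev polynomials in
    X, so the resulting map of the disk is smooth, including at the ends.

    The curves over the angle theta all follow one model curve: radial at
    distance 1 or more from the axis, and bent in between so as to pass from the
    angle theta to - theta. This is abscissa cos(theta) sqrt(prof(s^2)) and
    ordinate s sin(theta), where the signed radius s is affine along the chord.
    Curves over different angles of [0, pi] are then disjoint, whereas curves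
    over the same angle are parts of one curve. When sin(theta) = 0 the model
    degenerates to a part of the x axis covered twice, so [weight] mixes in the
    interpolated radius there. The weight vanishes to second order at the angles
    that matter, the multiples of pi / p that are not multiples of pi, and its
    exponent M is taken so large that it creates no intersection
    ([strands_apart]) and keeps the map an immersion ([gF_immersion]).

    Two points of the disk with the same image lie therefore on strands v and w
    at the same height, cos(p v) = cos(p w), and with cos(N v) = cos(N w).
    Since N and p are coprime each strand has at most one such partner
    ([meet_unique]), so the double arcs are disjoint. The two strands run along
    the same model curve, and everything depends on how their intervals of radii
    overlap: nested intervals give a ribbon arc, overlapping ones a clasp. The
    two differences of end radii have a product of the sign of
    sin(P)^2 - sin(c)^2, where P is a multiple of q pi / p ([gap_prod]). As p and
    q are coprime, P is not a multiple of pi, and moreover t1 can be chosen with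
    |sin c| < sin(pi / p) ([small_phase]). So the intervals are nested, and the
    singularities are ribbon ([ribbon_disk_singularities]). The phase is not
    critical, which gives sin c <> 0 when N > 1 ([phase_nondegenerate]); this is
    what keeps the disk immersed and embedded along the strands with
    sin(theta) = 0. *)

Set Implicit Arguments.
Unset Strict Implicit.
Unset Printing Implicit Defensive.

Import Order.TTheory GRing.Theory Num.Theory.
Import numFieldNormedType.Exports.

Local Open Scope classical_set_scope.
Local Open Scope ring_scope.

(** * Smooth functions *)

Lemma is_derive_lineP (R : realType) (V W : normedModType R) (f : V -> W)
    (x v : V) (df : W) :
  is_derive x v f df <-> is_derive (0 : R) 1 (fun r => f (r *: v + x)) df.
Proof.
have E : 'D_1 (fun r : R => f (r *: v + x)) 0 = 'D_v f x.
  rewrite /derive; set a := fun h => h^-1 *: _; set b := fun h => h^-1 *: _.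
  suff -> : a = b by []; rewrite funeqE /a /b => h /=.
  by rewrite scale0r add0r addr0 [h%:A]mulr1.
have [D1 D2] := derivable1P f x v.
split=> -[d Hd].
- by apply: DeriveDef; [exact: D1|rewrite E].
- by apply: DeriveDef; [exact: D2|rewrite -E].
Qed.

Lemma is_derive_comp1 (R : realType) (V : normedModType R) (g : V -> R)
    (h : R -> R) (x v : V) (dg dh : R) :
  is_derive x v g dg -> is_derive (g x) 1 h dh ->
  is_derive x v (fun y => h (g y)) (dh * dg).
Proof.
move=> /is_derive_lineP Hg Hh; apply/is_derive_lineP.
have Hh' : is_derive (g ((0 : R) *: v + x)) 1 h dh by rewrite scale0r add0r.
exact: (@is_derive1_comp _ h (fun r : R => g (r *: v + x)) 0 _ _ Hh' Hg).
Qed.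

Lemma differentiable_comp1 (R : realType) (V : normedModType R) (g : V -> R)
    (h : R -> R) (x : V) (dh : R) :
  differentiable g x -> is_derive (g x) 1 h dh ->
  differentiable (fun y => h (g y)) x.
Proof.
move=> Hg [Hh _]; apply: (@differentiable_comp _ _ _ _ g h) => //.
exact/derivable1_diffP.
Qed.

(** Smoothness is established syntactically. A directional derivative of a
    member of this class is again a member, so differentiability of the members
    yields every [Ck k] by induction. In [sm_comp], [h] is a function together
    with all its successive derivatives, because differentiating replaces
    [h k] by [h k.+1]. *)
Inductive sm (R : realType) (n : nat) : ('rV[R]_n -> R) -> Prop :=
| sm_const c : sm (fun=> c)
| sm_coord i : sm (fun x => x 0 i)
| sm_add f g : sm f -> sm g -> sm (fun x => f x + g x)
| sm_mul f g : sm f -> sm g -> sm (fun x => f x * g x)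
| sm_inv f : sm f -> (forall x, f x != 0) -> sm (fun x => (f x)^-1)
| sm_sqrt f : sm f -> (forall x, 0 < f x) -> sm (fun x => Num.sqrt (f x))
| sm_comp (h : nat -> R -> R) (k : nat) f : sm f ->
    (forall j (t : R), is_derive t 1 (h j) (h j.+1 t)) -> sm (fun x => h k (f x)).

Lemma is_derive_coord (R : realType) n (x v : 'rV[R]_n) i :
  is_derive x v (fun y : 'rV[R]_n => y 0 i) (v 0 i).
Proof.
apply: DeriveDef; first exact/diff_derivable/differentiable_coord.
rewrite deriveE; last exact: differentiable_coord.
have [f Ef] : exists f : {linear 'rV[R]_n -> R}, forall N, f N = N 0 i.
  by unshelve eexists; [exists (fun N : 'rV[R]_n => N 0 i);
     do 2![eexists]; do ?[constructor];
     rewrite ?mxE// => ? *; rewrite ?mxE//; move=> ?; rewrite !mxE|].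
have -> : (fun y : 'rV[R]_n => y 0 i) = f by rewrite funeqE => N; rewrite Ef.
rewrite diff_lin ?Ef //.
have -> : (f : 'rV[R]_n -> R) = (fun y : 'rV[R]_n => y 0 i).
  by rewrite funeqE => N; rewrite Ef.
exact: coord_continuous.
Qed.

Lemma sm_differentiable (R : realType) n (f : 'rV[R]_n -> R) :
  sm f -> forall x, differentiable f x.
Proof.
elim=> {f} [c|i|f g _ Hf _ Hg|f g _ Hf _ Hg|f _ Hf H0|f _ Hf H0|h k f _ Hf Hh] x.
- exact: differentiable_cst.
- exact: differentiable_coord.
- exact: differentiableD.
- exact: differentiableM.
- exact: differentiableV.
- apply: (@differentiable_comp1 _ _ f Num.sqrt x) => //.
  exact: is_derive1_sqrt.
- exact: (@differentiable_comp1 _ _ f (h k) x _ (Hf x) (Hh k _)).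
Qed.

Lemma sm_is_derive (R : realType) n (f : 'rV[R]_n -> R) (x v : 'rV[R]_n) :
  sm f -> is_derive x v f ('D_v f x).
Proof. by move=> Hf; apply/derivableP/diff_derivable/sm_differentiable. Qed.

Lemma sm_derive (R : realType) n (f : 'rV[R]_n -> R) (v : 'rV[R]_n) :
  sm f -> sm (fun x => 'D_v f x).
Proof.
elim=> {f} [c|i|f g Sf Hf Sg Hg|f g Sf Hf Sg Hg|f Sf Hf H0|f Sf Hf H0
           |h k f Sf Hf Hh].
- have -> : (fun x => 'D_v (fun=> c) x) = (fun x : 'rV[R]_n => 0 : R).
    by rewrite funeqE => x; apply: derive_cst.
  exact: sm_const.
- have -> : (fun x => 'D_v (fun y : 'rV[R]_n => y 0 i) x) = fun=> v 0 i.
    by rewrite funeqE => x; have [] := is_derive_coord x v i.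
  exact: sm_const.
- have -> : (fun x => 'D_v (fun y => f y + g y) x) =
            fun x => 'D_v f x + 'D_v g x.
    rewrite funeqE => x; have Df := sm_is_derive x v Sf.
    have Dg := sm_is_derive x v Sg.
    by have [] := is_deriveD Df Dg.
  exact: sm_add.
- have -> : (fun x => 'D_v (fun y => f y * g y) x) =
            fun x => f x * 'D_v g x + g x * 'D_v f x.
    rewrite funeqE => x; have Df := sm_is_derive x v Sf.
    have Dg := sm_is_derive x v Sg.
    by have [] := is_deriveM Df Dg.
  by apply: sm_add; apply: sm_mul.
- have -> : (fun x => 'D_v (fun y => (f y)^-1) x) =
            fun x => (-1) * ((f x)^-1 * ((f x)^-1 * 'D_v f x)).
    rewrite funeqE => x; rewrite deriveV //; last exact/diff_derivable/sm_differentiable.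
    by rewrite mulN1r scaleNr mulrA -invfM -expr2.
  apply: sm_mul; first exact: sm_const.
  apply: sm_mul; first exact: sm_inv.
  by apply: sm_mul; first exact: sm_inv.
- have -> : (fun x => 'D_v (fun y => Num.sqrt (f y)) x) =
            fun x => (2 * Num.sqrt (f x))^-1 * 'D_v f x.
    rewrite funeqE => x.
    by have [] := is_derive_comp1 (sm_is_derive x v Sf) (is_derive1_sqrt (H0 x)).
  apply: sm_mul => //; apply: sm_inv.
    by apply: sm_mul; [exact: sm_const|exact: sm_sqrt].
  by move=> x; rewrite mulf_neq0 ?pnatr_eq0// gt_eqF// sqrtr_gt0.
- have -> : (fun x => 'D_v (fun y => h k (f y)) x) =
            fun x => h k.+1 (f x) * 'D_v f x.
    rewrite funeqE => x.
    by have [] := is_derive_comp1 (sm_is_derive x v Sf) (Hh k (f x)).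
  by apply: sm_mul => //; apply: (@sm_comp _ _ h).
Qed.

Lemma sm_opp (R : realType) n (f : 'rV[R]_n -> R) : sm f -> sm (fun x => - f x).
Proof.
move=> Sf; have -> : (fun x => - f x) = (fun x => (-1) * f x).
  by rewrite funeqE => x; rewrite mulN1r.
by apply: sm_mul => //; apply: sm_const.
Qed.

Lemma sm_sub (R : realType) n (f g : 'rV[R]_n -> R) :
  sm f -> sm g -> sm (fun x => f x - g x).
Proof. by move=> Sf Sg; apply: sm_add => //; apply: sm_opp. Qed.

Lemma sm_exp (R : realType) n (f : 'rV[R]_n -> R) k :
  sm f -> sm (fun x => f x ^+ k).
Proof.
move=> Sf; elim: k => [|k IH].
  by rewrite (_ : (fun _ => _) = fun=> 1) ?funeqE//; exact: sm_const.
rewrite (_ : (fun _ => _) = fun x => f x * f x ^+ k); first exact: sm_mul.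
by rewrite funeqE => x; rewrite exprS.
Qed.

Lemma sm_horner (R : realType) n (f : 'rV[R]_n -> R) (P : {poly R}) :
  sm f -> sm (fun x => P.[f x]).
Proof.
move=> Sf; elim/poly_ind: P => [|P c IH].
  by rewrite (_ : (fun _ => _) = fun=> 0) ?funeqE; [exact: sm_const|
     move=> x; rewrite horner0].
rewrite (_ : (fun _ => _) = fun x => P.[f x] * f x + c).
  by apply: sm_add; [exact: sm_mul|exact: sm_const].
by rewrite funeqE => x; rewrite !hornerE.
Qed.

Lemma sm_sum (R : realType) n m (f : 'I_m -> 'rV[R]_n -> R) :
  (forall i, sm (f i)) -> sm (fun x => \sum_i f i x).
Proof.
elim: m f => [|m IH] f Sf.
  rewrite (_ : (fun _ => _) = fun=> 0); first exact: sm_const.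
  by rewrite funeqE => x; rewrite big_ord0.
rewrite (_ : (fun _ => _) = fun x => f ord0 x + \sum_i f (lift ord0 i) x).
  by apply: sm_add => //; apply: IH.
by rewrite funeqE => x; rewrite big_ord_recl.
Qed.

Lemma sm_subst (R : realType) n m (f : 'rV[R]_m -> R) (g : 'rV[R]_n -> 'rV[R]_m) :
  sm f -> (forall i, sm (fun x => g x 0 i)) -> sm (fun x => f (g x)).
Proof.
move=> Sf Sg; elim: Sf => {f} [c|i|f1 f2 _ H1 _ H2|f1 f2 _ H1 _ H2|f1 _ H1 H0
  |f1 _ H1 H0|h k f1 _ H1 Hh].
- exact: sm_const.
- exact: Sg.
- exact: sm_add.
- exact: sm_mul.
- exact: sm_inv.
- exact: sm_sqrt.
- exact: (@sm_comp _ _ h).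
Qed.

Definition smv (R : realType) n m (f : 'rV[R]_n -> 'rV[R]_m) : Prop :=
  forall i, sm (fun x => f x 0 i).

Lemma smv_differentiable (R : realType) n m (f : 'rV[R]_n -> 'rV[R]_m) :
  smv f -> forall x, differentiable f x.
Proof.
move=> Sf x.
have -> : f = \sum_(i < m) (fun x => f x 0 i *: delta_mx 0 i).
  rewrite funeqE => y; rewrite fct_sumE {1}(row_sum_delta (f y)) //.
apply: differentiable_sum => i; apply: differentiableZl.
exact: sm_differentiable.
Qed.

Lemma smv_deriveE (R : realType) n m (f : 'rV[R]_n -> 'rV[R]_m)
    (x v : 'rV[R]_n) i :
  smv f -> 'D_v f x 0 i = 'D_v (fun y => f y 0 i) x.
Proof.
by move=> Sf; rewrite derive_mx ?mxE //; apply/diff_derivable/smv_differentiable.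
Qed.

Lemma smv_smooth (R : realType) n m (f : 'rV[R]_n -> 'rV[R]_m) :
  smv f -> smooth f.
Proof.
move=> Sf k; elim: k f Sf => [|k IH] f Sf /=.
  by move=> x; apply/differentiable_continuous/smv_differentiable.
split=> [x|v]; first exact: smv_differentiable.
apply: IH => i; rewrite (_ : (fun _ => _) = fun x => 'D_v (fun y => f y 0 i) x).
  exact: sm_derive.
by rewrite funeqE => x; rewrite smv_deriveE.
Qed.

Lemma jacobian_comp (R : realType) n m l (g : 'rV[R]_n -> 'rV[R]_m)
    (f : 'rV[R]_m -> 'rV[R]_l) x :
  differentiable g x -> differentiable f (g x) ->
  'J (fun y => f (g y)) x = 'J g x *m 'J f (g x).
Proof.
move=> Dg Df; apply/row_matrixP => i; rewrite !rowE mulmxA /jacobian !mul_rV_lin1.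
by rewrite (diff_comp Dg Df).
Qed.

Lemma row2P (P : 'I_2 -> Prop) : P 0 -> P 1 -> forall i, P i.
Proof.
move=> P0 P1 i; have [->|->] : i = 0 \/ i = 1 => //.
by case: i => -[|[|//]] H; [left|right]; apply: val_inj.
Qed.

Lemma row3P (P : 'I_3 -> Prop) : P 0 -> P 1 -> P 2%:R -> forall i, P i.
Proof.
move=> P0 P1 P2 i; have [->|->|->] : [\/ i = 0, i = 1 | i = 2%:R] => //.
by case: i => -[|[|[|//]]] H; [constructor 1|constructor 2|constructor 3];
   apply: val_inj.
Qed.

(** * A smooth profile *)

(** The functions P(1/x) exp(-1/x), extended by 0 to the left, are closed under
    differentiation; P = 1 gives the flat function behind all smooth cutoffs. *)
Definition flat (R : realType) (P : {poly R}) (x : R) : R :=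
  if 0 < x then P.[x^-1] * expR (- x^-1) else 0.

Lemma horner_pow_bound (R : realType) (P : {poly R}) :
  exists (K : R) (d : nat), 0 <= K /\ forall y, 1 <= y -> `|P.[y]| <= K * y ^+ d.
Proof.
elim/poly_ind: P => [|P c [K [d [K0 HK]]]].
  by exists 0, 0%N; split=> // y _; rewrite horner0 normr0 mul0r.
exists (K + `|c|), d.+1; split=> [|y y1]; first by rewrite addr_ge0.
have y0 : 0 <= y by rewrite (le_trans ler01).
rewrite hornerD hornerMX hornerC (le_trans (ler_normD _ _))// mulrDl lerD//.
  by rewrite normrM (ger0_norm y0) exprSr mulrA ler_wpM2r// HK.
by rewrite ler_peMr// exprn_ege1.
Qed.

(** The exponential beats the pole of P(1/x): exp(-1/x) <= (n x)^n for every
    n, and n is taken two larger than the degree of P. *)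
Lemma flat_bound (R : realType) (P : {poly R}) :
  exists K : R, forall h, h <= 1 -> `|flat P h| <= K * h ^+ 2.
Proof.
have [K [d [K0 HK]]] := horner_pow_bound P.
exists (K * d.+2%:R ^+ d.+2) => h h1; rewrite /flat; case: ifPn => h0; last first.
  by rewrite normr0 mulr_ge0 ?sqr_ge0// mulr_ge0// exprn_ge0.
have hV1 : 1 <= h^-1 by rewrite invr_ge1// unitfE gt_eqF.
rewrite normrM (ger0_norm (expR_ge0 _)).
(* With n = d + 2 and y = 1/h: exp(y) = exp(y/n)^n >= (y/n)^n. *)
have E : expR (- h^-1) <= (d.+2%:R * h) ^+ d.+2.
  have n0 : 0 < d.+2%:R :> R by rewrite ltr0n.
  have -> : - h^-1 = d.+2%:R * (- (d.+2%:R * h)^-1).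
    by field; rewrite !gt_eqF// pnatr_eq0.
  rewrite expRM_natl lerXn2r ?nnegrE ?expR_ge0 ?mulr_ge0 ?ltW//.
  rewrite expRN invf_plt ?posrE ?expR_gt0 ?mulr_gt0//.
  by rewrite (lt_le_trans _ (expR_ge1Dx _))// ltrDr.
rewrite (le_trans (ler_pM _ _ (HK _ hV1) E)) ?expR_ge0//.
have E2 : h^-1 ^+ d * h ^+ d.+2 = h ^+ 2.
  by rewrite -[in h ^+ _]addn2 exprD mulrA -exprMn mulVf ?gt_eqF// expr1n mul1r.
by rewrite exprMn mulrACA E2.
Qed.

Lemma is_derive_quadratic (R : realType) (F : R -> R) (K : R) :
  (forall h, h <= 1 -> `|F h| <= K * h ^+ 2) -> is_derive (0 : R) 1 F 0.
Proof.
move=> HF; have F0 : F 0 = 0.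
  by apply/eqP; rewrite -normr_le0 (le_trans (HF _ _))// expr0n mulr0.
have C : (fun h : R => h^-1 *: ((F \o shift 0) (h *: 1) - F 0)) @ 0^' --> (0 : R).
  apply/cvgr0Pnorm_lt => e e0.
  have K1 : 0 < `|K| + 1 by rewrite ltr_wpDl.
  near=> h.
  have h0 : h != 0 by near: h; exact: nbhs_dnbhs_neq.
  have he : `|h| < e / (`|K| + 1) by near: h; apply: dnbhs0_lt; rewrite divr_gt0.
  have h1 : `|h| < 1 by near: h; exact: dnbhs0_lt.
  rewrite /= F0 subr0 addr0 [h%:A]mulr1 normrZ normfV.
  rewrite ltr_pdivrMl ?normr_gt0//.
  apply: (le_lt_trans (HF _ _)); first by rewrite (le_trans (ler_norm _)) ?ltW.
  rewrite -real_normK ?num_real// expr2 mulrCA ltr_pM2l ?normr_gt0//.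
  rewrite ltr_pdivlMr// in he; apply: le_lt_trans he.
  rewrite mulrC ler_wpM2l//.
  by rewrite (le_trans (ler_norm _))// lerDl.
apply: DeriveDef; first by apply/cvg_ex; exists 0.
exact: cvg_lim C.
Unshelve. all: by end_near. Qed.

Lemma is_derive_flat (R : realType) (P : {poly R}) (x : R) :
  is_derive x 1 (flat P) (flat ('X^2 * (P - P^`())) x).
Proof.
have [x0|x0|->] := ltgtP x 0.
- apply: (@near_eq_is_derive _ _ _ (fun=> 0)).
    near=> y; have y0 : y < 0 by near: y; exact: lt_nbhsl.
    by rewrite /flat ltNge ltW.
  by rewrite /flat ltNge ltW//=; apply: is_derive_cst.
- apply: (@near_eq_is_derive _ _ _ (fun y : R => P.[y^-1] * expR (- y^-1) : R)).
    near=> y; have y0 : 0 < y by near: y; exact: lt_nbhsr.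
    by rewrite /flat y0.
  have xn0 : x != 0 by rewrite gt_eqF.
  have DV : is_derive x 1 (fun y : R => y^-1) (- x ^- 2).
    apply: DeriveDef; first by apply: derivableV => //; exact: derivable_id.
    by rewrite (@deriveV _ _ id)// ?derive_id ?scaler1//; exact: derivable_id.
  have DE : is_derive (- x^-1) 1 (@expR R) (expR (- x^-1)).
    exact: is_derive_expR.
  have D1 := is_derive_comp1 DV (is_derive_poly P x^-1).
  have D2 := is_derive_comp1 (is_deriveN DV) DE.
  apply: (is_derive_eq (is_deriveM D1 D2)).
  rewrite /flat x0 !hornerE /=.
  by rewrite /GRing.scale /=; field.
- have [K HK] := flat_bound P.
  rewrite {2}/flat ltxx; exact: is_derive_quadratic HK.
Unshelve. all: by end_near. Qed.

Definition flat_exp (R : realType) (x : R) : R := flat 1 x.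
Definition dflat_exp (R : realType) (x : R) : R := flat 'X^2 x.

Lemma is_derive_flat_exp (R : realType) (x : R) : is_derive x 1 (@flat_exp R) (dflat_exp x).
Proof.
by have := is_derive_flat 1 x; rewrite derivC subr0 mulr1.
Qed.

Lemma flat_exp_gt0 (R : realType) (x : R) : 0 < x -> 0 < flat_exp x.
Proof. by move=> x0; rewrite /flat_exp /flat x0 hornerC mul1r expR_gt0. Qed.

Lemma flat_exp_eq0 (R : realType) (x : R) : x <= 0 -> flat_exp x = 0.
Proof. by move=> x0; rewrite /flat_exp /flat ltNge x0. Qed.

Lemma flat_exp_ge0 (R : realType) (x : R) : 0 <= flat_exp x.
Proof. by have [/flat_exp_eq0->//|/flat_exp_gt0/ltW] := leP x 0. Qed.

Lemma dflat_exp_eq0 (R : realType) (x : R) : x <= 0 -> dflat_exp x = 0.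
Proof. by move=> x0; rewrite /dflat_exp /flat ltNge x0. Qed.

Lemma dflat_exp_ge0 (R : realType) (x : R) : 0 <= dflat_exp x.
Proof.
rewrite /dflat_exp /flat; case: ifP => // _.
by rewrite mulr_ge0 ?expR_ge0// hornerXn sqr_ge0.
Qed.

Lemma continuous_flat (R : realType) (P : {poly R}) : continuous (flat P).
Proof.
move=> x; apply/differentiable_continuous/derivable1_diffP.
by case: (is_derive_flat P x).
Qed.

Lemma sm_flat_exp (R : realType) n (f : 'rV[R]_n -> R) : sm f -> sm (fun x => flat_exp (f x)).
Proof.
pose h k : R -> R := flat (iter k (fun P => 'X^2 * (P - P^`())) 1).
move=> Sf; apply: (@sm_comp _ _ h 0) => // j t; exact: is_derive_flat.
Qed.

Definition step_den (R : realType) (t : R) : R := flat_exp (t - 4^-1) + flat_exp (1 - t).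

Lemma step_den_gt0 (R : realType) (t : R) : 0 < step_den t.
Proof.
rewrite /step_den; have [t1|t1] := ltP t 1.
  by rewrite ltr_wpDl ?flat_exp_ge0// flat_exp_gt0// subr_gt0.
rewrite ltr_wpDr ?flat_exp_ge0// flat_exp_gt0// subr_gt0 (lt_le_trans _ t1)//.
by rewrite invf_lt1// ltr1n.
Qed.

Definition step (R : realType) (t : R) : R := flat_exp (t - 4^-1) / step_den t.

Definition dstep (R : realType) (t : R) : R :=
  (dflat_exp (t - 4^-1) * flat_exp (1 - t) + flat_exp (t - 4^-1) * dflat_exp (1 - t)) /
  step_den t ^+ 2.

(** A positive nondecreasing smooth function that is the identity from 1 on and
    is constant up to 1/4. Hence sqrt(prof(s^2)) is a smooth positive even
    function of s which is exactly |s| as soon as |s| >= 1: radial segments at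
    distance at least 1 from the axis can be continued smoothly to a curve that
    crosses from one side to the other. *)
Definition prof (R : realType) (t : R) : R := 4^-1 + (t - 4^-1) * step t.
Definition dprof (R : realType) (t : R) : R := step t + (t - 4^-1) * dstep t.

Lemma is_derive_prof (R : realType) (t : R) : is_derive t 1 (@prof R) (dprof t).
Proof.
have Da : is_derive t 1 (fun y : R => y - 4^-1) 1.
  by apply: (is_derive_eq (is_deriveB (is_derive_id t 1) (is_derive_cst _ t 1)));
     rewrite subr0.
have Db : is_derive t 1 (fun y : R => 1 - y) (-1).
  by apply: (is_derive_eq (is_deriveB (is_derive_cst (1 : R) t 1) (is_derive_id t 1)));
     rewrite sub0r.
have D1 := is_derive_comp1 Da (is_derive_flat_exp _).
have D2 := is_derive_comp1 Db (is_derive_flat_exp _).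
have Dd := is_deriveD D1 D2.
have d0 : step_den t != 0 by rewrite gt_eqF ?step_den_gt0.
have DV : is_derive t 1 (fun y : R => (step_den y)^-1)
    (- step_den t ^- 2 *: (dflat_exp (t - 4^-1) * 1 + dflat_exp (1 - t) * -1)).
  have [De Ev] : is_derive t 1 (@step_den R) _ := Dd.
  apply: DeriveDef; first exact: derivableV.
  by rewrite deriveV// Ev.
have DS := is_deriveM D1 DV.
apply: (is_derive_eq (is_deriveD (is_derive_cst (4^-1 : R) t 1) (is_deriveM Da DS))).
rewrite /dprof /dstep /step /= /GRing.scale /=.
by rewrite /step_den in d0 *; rewrite !fctE; field.
Qed.

Lemma prof_ge (R : realType) (t : R) : 4^-1 <= prof t.
Proof.
rewrite /prof lerDl /step; have [t0|t0] := leP t 4^-1.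
  by rewrite flat_exp_eq0 ?mul0r ?mulr0// subr_le0.
by rewrite mulr_ge0 ?subr_ge0 ?ltW// divr_gt0 ?step_den_gt0// flat_exp_gt0// subr_gt0.
Qed.

Lemma prof_gt0 (R : realType) (t : R) : 0 < prof t.
Proof. by rewrite (lt_le_trans _ (prof_ge t))// invr_gt0. Qed.

Lemma step1 (R : realType) (t : R) : 1 <= t -> step t = 1.
Proof.
move=> t1; rewrite /step /step_den (@flat_exp_eq0 _ (1 - t)) ?subr_le0// addr0 divff//.
rewrite gt_eqF// flat_exp_gt0// subr_gt0 (lt_le_trans _ t1)//.
by rewrite invf_lt1// ltr1n.
Qed.

Lemma prof_id (R : realType) (t : R) : 1 <= t -> prof t = t.
Proof. by move=> t1; rewrite /prof step1// mulr1 addrC subrK. Qed.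

Lemma dprof1 (R : realType) (t : R) : 1 <= t -> dprof t = 1.
Proof.
move=> t1; rewrite /dprof step1// /dstep (@flat_exp_eq0 _ (1 - t)) ?subr_le0//.
by rewrite (@dflat_exp_eq0 _ (1 - t)) ?subr_le0// !mulr0 addr0 mul0r mulr0 addr0.
Qed.

Lemma prof_quarter (R : realType) (t : R) : t <= 4^-1 -> prof t = 4^-1.
Proof.
by move=> t1; rewrite /prof /step flat_exp_eq0 ?subr_le0// mul0r mulr0 addr0.
Qed.

Lemma dprof_ge0 (R : realType) (t : R) : 0 <= dprof t.
Proof.
have [t0|t0] := leP t 4^-1.
  rewrite /dprof /step /dstep (@flat_exp_eq0 _ (t - _)) ?subr_le0//.
  rewrite (@dflat_exp_eq0 _ (t - _)) ?subr_le0//.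
  by rewrite !mul0r addr0 mul0r mulr0 addr0.
rewrite /dprof addr_ge0//.
  by rewrite divr_ge0 ?flat_exp_ge0// ltW// step_den_gt0.
rewrite mulr_ge0 ?subr_ge0 ?(ltW t0)// /dstep divr_ge0 ?sqr_ge0//.
by rewrite addr_ge0// mulr_ge0 ?flat_exp_ge0 ?dflat_exp_ge0.
Qed.

Lemma continuous_dprof (R : realType) : continuous (@dprof R).
Proof.
move=> t /=.
have Ca : {for t, continuous (fun y : R => y - 4^-1)}.
  by apply: cvgB; [exact: cvg_id|exact: cvg_cst].
have Cb : {for t, continuous (fun y : R => 1 - y)}.
  by apply: cvgB; [exact: cvg_cst|exact: cvg_id].
have Fa (P : {poly R}) : {for t, continuous (fun y : R => flat P (y - 4^-1))}.
  by apply: (@continuous_comp _ _ _ (fun y : R => y - 4^-1) (flat P)) => //;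
     exact: continuous_flat.
have Fb (P : {poly R}) : {for t, continuous (fun y : R => flat P (1 - y))}.
  by apply: (@continuous_comp _ _ _ (fun y : R => 1 - y) (flat P)) => //;
     exact: continuous_flat.
have Cd : {for t, continuous (@step_den R)} by apply: cvgD; [exact: Fa|exact: Fb].
have d0 : step_den t != 0 by rewrite gt_eqF ?step_den_gt0.
apply: cvgD.
  by apply: cvgM; [exact: Fa|apply: cvgV].
apply: cvgM => //; apply: cvgM.
  by apply: cvgD; apply: cvgM; [exact: Fa|exact: Fb|exact: Fa|exact: Fb].
apply: cvgV; first by rewrite expf_neq0.
by rewrite [X in _ --> X]expr2; apply: cvgM.
Qed.

Lemma prof_mvt (R : realType) (s t : R) : s <= t ->
  exists2 c, c \in `[s, t] & prof t - prof s = dprof c * (t - s).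
Proof.
move=> st; apply: (MVT_segment st (fun x _ => is_derive_prof x)).
apply: continuous_subspaceT => x; apply/differentiable_continuous/derivable1_diffP.
by case: (is_derive_prof x).
Qed.

Lemma le_prof (R : realType) (s t : R) : s <= t -> prof s <= prof t.
Proof.
move=> st; have [c _ E] := prof_mvt st.
by rewrite -subr_ge0 E mulr_ge0 ?dprof_ge0 ?subr_ge0.
Qed.

Lemma prof_lipschitz (R : realType) (b : R) : 0 <= b ->
  exists2 L : R, 1 <= L & forall s t, 0 <= s -> s <= t -> t <= b ->
    prof t <= prof s + L * (t - s).
Proof.
move=> b0; have Cd : {within `[0, b], continuous (@dprof R)}.
  by apply: continuous_subspaceT; exact: continuous_dprof.
have [c _ Hc] := EVT_max b0 Cd.
exists (1 + `|dprof c|) => [|s t s0 st tb]; first by rewrite lerDl.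
have [d + E] := prof_mvt st; rewrite in_itv/= => /andP[sd dt].
have L1 : dprof d <= 1 + `|dprof c|.
  rewrite (le_trans (Hc d _)) ?in_itv/= ?(le_trans s0 sd) ?(le_trans dt tb)//.
  by rewrite (le_trans (ler_norm _))// lerDr.
by rewrite -lerBlDl E ler_wpM2r// subr_ge0.
Qed.

Lemma sm_prof (R : realType) n (f : 'rV[R]_n -> R) : sm f -> sm (fun x => prof (f x)).
Proof.
move=> Sf; have Sa : sm (fun x => f x - 4^-1) by apply: sm_sub => //; apply: sm_const.
have Sb : sm (fun x => 1 - f x) by apply: sm_sub => //; apply: sm_const.
apply: sm_add; first exact: sm_const.
apply: sm_mul => //; apply: sm_mul; first exact: sm_flat_exp.
apply: sm_inv => [|x]; first by apply: sm_add; exact: sm_flat_exp.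
by rewrite gt_eqF ?step_den_gt0.
Qed.

(** * Multiples of pi *)

Definition pimul (R : realType) (x : R) : Prop := exists k : int, x = k%:~R * pi.

Lemma pimulD (R : realType) (x y : R) : pimul x -> pimul y -> pimul (x + y).
Proof. by move=> [k ->] [l ->]; exists (k + l); rewrite intrD mulrDl. Qed.

Lemma pimulZ (R : realType) (x : R) (k : int) : pimul x -> pimul (k%:~R * x).
Proof. by move=> [l ->]; exists (k * l); rewrite intrM mulrA. Qed.

Lemma pimulN (R : realType) (x : R) : pimul x -> pimul (- x).
Proof. by move=> /(pimulZ (-1)); rewrite mulN1r. Qed.

Lemma pimulB (R : realType) (x y : R) : pimul x -> pimul y -> pimul (x - y).
Proof. by move=> Hx /pimulN; apply: pimulD. Qed.

Lemma pimulMn (R : realType) (x : R) (n : nat) : pimul x -> pimul (n%:R * x).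
Proof. exact: (@pimulZ _ _ n%:Z). Qed.

Lemma pimul_small (R : realType) (x : R) : pimul x -> - pi < x < pi -> x = 0.
Proof.
move=> [k ->] /andP[H1 H2].
have {}H1 : -1 < k%:~R :> R by rewrite -(ltr_pM2r (pi_gt0 R)) mulN1r.
have {}H2 : k%:~R < 1 :> R by rewrite -(ltr_pM2r (pi_gt0 R)) mul1r.
rewrite (ltr_int _ (-1)) in H1; rewrite (ltr_int _ _ 1) in H2.
have -> : k = 0 by lia.
by rewrite mul0r.
Qed.

Lemma pimul_pi (R : realType) : @pimul R pi.
Proof. by exists 1; rewrite mul1r. Qed.

Lemma cos_pimul (R : realType) (x y : R) : pimul y ->
  exists e : R, e ^+ 2 = 1 /\ cos (x + y) = e * cos x /\ sin (x + y) = e * sin x.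
Proof.
move=> [k ->].
have key (n : nat) : exists e : R, e ^+ 2 = 1 /\
    cos (n%:R * pi) = e /\ sin (n%:R * pi) = 0 :> R.
  elim: n => [|n [e [e1 [Ec Es]]]].
    by exists 1; rewrite expr1n mul0r cos0 sin0.
  exists (- e); rewrite sqrrN e1; split=> //.
  by rewrite -natr1 mulrDl mul1r cosDpi sinDpi Ec Es oppr0.
have [e [e1 [Ec Es]]] : exists e : R, e ^+ 2 = 1 /\
    cos (k%:~R * pi) = e /\ sin (k%:~R * pi) = 0 :> R.
  case: k => n; first exact: key.
  have [e [e1 [Ec Es]]] := key n.+1; exists e; split=> //.
  by rewrite NegzE mulrNz mulNr cosN sinN Ec Es oppr0.
by exists e; rewrite cosD sinD Ec Es !mulr0 subr0 addr0 ![_ * e]mulrC.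
Qed.

Lemma sin_eq0P (R : realType) (x : R) : sin x = 0 <-> pimul x.
Proof.
split=> [s0|]; last first.
  by move=> /(cos_pimul 0) [e [_ [_ H]]]; move: H; rewrite add0r => ->; rewrite sin0 mulr0.
pose k := Num.floor (x / pi).
have pi0 := pi_gt0 R.
have [k1 k2] : k%:~R * pi <= x /\ x < k%:~R * pi + pi.
  have := floor_itv (x / pi); rewrite -/k => /andP[H1 H2].
  rewrite -ler_pdivlMr// H1; split=> //.
  by rewrite -[X in _ + X]mul1r -mulrDl -ltr_pdivrMr// -(intrD _ _ 1).
have [y0|y0] := eqVneq (x - k%:~R * pi) 0.
  by exists k; apply/eqP; rewrite -subr_eq0 y0.
have : 0 < sin (x - k%:~R * pi).
  apply: sin_gt0_pi; rewrite lt_neqAle eq_sym y0 subr_ge0 k1/=.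
  by rewrite ltrBlDl.
have [e [_ [_ ->]]] : exists e : R, e ^+ 2 = 1 /\ cos (x - k%:~R * pi) = e * cos x
    /\ sin (x - k%:~R * pi) = e * sin x.
  by apply: cos_pimul; apply: pimulN; exists k.
by rewrite s0 mulr0 ltxx.
Qed.

Lemma cosB_prod (R : realType) (a b : R) :
  cos a - cos b = - 2 * (sin ((a + b) / 2) * sin ((a - b) / 2)).
Proof.
have Ea : a = (a + b) / 2 + (a - b) / 2 by field.
have Eb : b = (a + b) / 2 - (a - b) / 2 by field.
by rewrite [in cos a]Ea [in cos b]Eb cosD cosB; ring.
Qed.

Lemma sinB_prod (R : realType) (a b : R) :
  sin a - sin b = 2 * (cos ((a + b) / 2) * sin ((a - b) / 2)).
Proof.
have Ea : a = (a + b) / 2 + (a - b) / 2 by field.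
have Eb : b = (a + b) / 2 - (a - b) / 2 by field.
by rewrite [in sin a]Ea [in sin b]Eb sinD sinB; ring.
Qed.

Lemma cos_eqP (R : realType) (a b : R) :
  cos a = cos b -> pimul ((a + b) / 2) \/ pimul ((a - b) / 2).
Proof.
move=> E; have : sin ((a + b) / 2) * sin ((a - b) / 2) = 0.
  have := cosB_prod a b; rewrite E subrr => /esym/eqP.
  by rewrite mulf_eq0 oppr_eq0 pnatr_eq0/= => /eqP.
by move/eqP; rewrite mulf_eq0 => /orP[] /eqP /sin_eq0P; [left|right].
Qed.

Lemma pimul_coprime (R : realType) (m n : nat) (x : R) : coprime m n ->
  pimul (m%:R * x) -> pimul (n%:R * x) -> pimul x.
Proof.
move=> co Hm Hn; have : coprimez m n by [].
move=> /coprimezP [[u v] /= uv].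
have -> : x = u%:~R * (m%:R * x) + v%:~R * (n%:R * x).
  rewrite !mulrA -mulrDl -[X in X = _]mul1r; congr (_ * _).
  by rewrite -[LHS]/(1%:~R) -uv rmorphD /= !rmorphM.
by apply: pimulD; apply: pimulZ.
Qed.

(** Modulo pi, x is r pi / p with 0 < r < p, and on this grid the sine is
    smallest next to the ends. *)
Lemma sin_sqr_min (R : realType) (p : nat) (x : R) : (0 < p)%N ->
  pimul (p%:R * x) -> ~ pimul x -> sin (pi / p%:R) ^+ 2 <= sin x ^+ 2.
Proof.
move=> p0 [k Ek] Nx.
have pR : 0 < p%:R :> R by rewrite ltr0n.
have pz : p%:Z != 0 by rewrite -lt0n.
have Ex : x = k%:~R * pi / p%:R by rewrite -Ek mulrAC divff ?mul1r// gt_eqF.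
have [r Er] : exists r : nat, (k %% p)%Z = r%:Z.
  by exists `|(k %% p)%Z|%N; rewrite gez0_abs// modz_ge0.
have rp : (r < p)%N by rewrite -ltz_nat -Er ltz_mod.
have Ex2 : x = r%:R * pi / p%:R + (k %/ p)%Z%:~R * pi.
  rewrite Ex {1}(divz_eq k p) Er rmorphD /= rmorphM /=.
  by rewrite -!pmulrn; field; rewrite gt_eqF.
have r0 : (0 < r)%N.
  rewrite lt0n; apply/eqP => r0; apply: Nx; rewrite Ex2 r0 !mul0r add0r.
  by exists (k %/ p)%Z.
have -> : sin x ^+ 2 = sin (r%:R * pi / p%:R) ^+ 2.
  have Hk : pimul ((k %/ p)%Z%:~R * pi : R) by exists (k %/ p)%Z.
  have [e [e1 [_ Es]]] := cos_pimul (r%:R * pi / p%:R) Hk.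
  rewrite Ex2 Es.
  by rewrite exprMn e1 mul1r.
have p1 : (1 : R) <= r%:R by rewrite ler1n.
have p2 : r%:R + 1 <= p%:R :> R by rewrite natr1 ler_nat.
have pi0 := pi_gt0 R; have pi0' := pi_ge0 R; have pR' := ltW pR.
have p3 : 1 <= p%:R :> R by rewrite ler1n.
have s0 : 0 <= sin (pi / p%:R : R).
  by apply: sin_ge0_pi; rewrite divr_ge0//= ler_pdivrMr// ler_peMr.
suff H : sin (pi / p%:R : R) <= sin (r%:R * pi / p%:R).
  by rewrite lerXn2r ?nnegrE// (le_trans s0).
rewrite -subr_ge0 sinB_prod !mulr_ge0//.
  have -> : (r%:R * pi / p%:R + pi / p%:R) / 2 = (r%:R + 1) / p%:R * (pi / 2) :> R.
    by field; rewrite gt_eqF.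
  have q0 : 0 <= (r%:R + 1) / p%:R :> R by rewrite divr_ge0 ?addr_ge0.
  have q1 : (r%:R + 1) / p%:R <= 1 :> R by rewrite ler_pdivrMr ?mul1r.
  have h0 : 0 <= pi / 2 :> R by rewrite divr_ge0.
  apply: cos_ge0_pihalf; rewrite (@le_trans _ _ 0) ?oppr_le0 ?mulr_ge0//=.
  by rewrite ler_piMl.
apply: sin_ge0_pi.
have -> : (r%:R * pi / p%:R - pi / p%:R) / 2 = (r%:R - 1) / (2 * p%:R) * pi :> R.
  by field; rewrite gt_eqF.
rewrite mulr_ge0 ?divr_ge0 ?mulr_ge0 ?subr_ge0//= ler_piMl//.
rewrite ler_pdivrMr ?mulr_gt0// mul1r; lra.
Qed.

(** As q is invertible modulo p, the number q j can be any integer modulo p, so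
    the phase can be moved modulo pi by any multiple of pi / p. *)
Lemma small_phase (R : realType) (p q : nat) (beta : R) :
  (1 < p)%N -> coprime p q ->
  exists j : int, sin (q%:R * (j%:~R * pi / p%:R) + beta) ^+ 2 <
                  sin (pi / p%:R) ^+ 2.
Proof.
move=> p1 co; have pi0 := pi_gt0 R; have pi0' := pi_ge0 R.
have pR : 0 < p%:R :> R by rewrite ltr0n (ltn_trans _ p1).
have pR2 : 2 <= p%:R :> R by rewrite ler_nat.
have : coprimez q p by rewrite /coprimez /gcdz gcdnC; exact: co.
move=> /coprimezP [[u v] /= uv].
pose a := - Num.floor (beta * p%:R / pi).
have /andP[F1 F2] := floor_itv (beta * p%:R / pi).
pose y := beta + a%:~R * pi / p%:R.
have Ey : y = (beta * p%:R / pi - (Num.floor (beta * p%:R / pi))%:~R) * (pi / p%:R).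
  have pin : pi != 0 :> R by rewrite gt_eqF.
  have pn : p%:R != 0 :> R by rewrite gt_eqF.
  rewrite /y /a rmorphN /=; move: (pi : R) pin => P Pn.
  by field; rewrite pn Pn.
have y0 : 0 <= y by rewrite Ey mulr_ge0 ?subr_ge0 ?divr_ge0 ?(ltW pR).
have y1 : y < pi / p%:R.
  rewrite Ey -[X in _ < X]mul1r ltr_pM2r ?divr_gt0// ltrBlDl.
  by rewrite rmorphD in F2.
have h2 : pi / p%:R <= pi / 2 :> R by rewrite ler_pM2l// lef_pV2 ?posrE.
have h0 : 0 <= pi / 2 :> R by rewrite divr_ge0.
clearbody a; exists (a * u).
have E : q%:R * ((a * u)%:~R * pi / p%:R) + beta = y + (- (a * v))%:~R * pi.
  have uvR : u%:~R * q%:R + v%:~R * p%:R = 1 :> R.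
    by rewrite -[RHS]/(1%:~R) -uv rmorphD /= !rmorphM.
  rewrite /y rmorphN !rmorphM /=.
  have -> : beta + a%:~R * pi / p%:R =
    beta + a%:~R * pi * (u%:~R * q%:R + v%:~R * p%:R) / p%:R by rewrite uvR mulr1.
  by field; rewrite gt_eqF.
have Hk : pimul ((- (a * v))%:~R * pi : R) by exists (- (a * v)).
have [e [e1 [_ Es]]] := cos_pimul y Hk.
have sy : 0 <= sin y by apply: sin_ge0_pi; rewrite y0/=; lra.
rewrite E Es exprMn e1 mul1r ltrXn2r//.
by rewrite ltr_sin ?in_itv//=; apply/andP; split; lra.
Qed.

Lemma cos_sqr_le1 (R : realType) (x : R) : cos x ^+ 2 <= 1.
Proof. by rewrite cos2sin2 gerDl oppr_le0 sqr_ge0. Qed.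

Lemma abs_le_sqr (R : realType) (x : R) : x ^+ 2 <= 1 -> -1 <= x <= 1.
Proof. by move=> x1; rewrite -ler_norml -sqrtr_sqr -(sqrtr1 R) ler_sqrt. Qed.

(** * Chebyshev polynomials *)

(** The pair (T_n, U_(n-1)) of polynomials of the first and second kind. The
    shifted index makes the second one satisfy V_n(cos v) sin v = sin(n v). *)
Fixpoint cheb (R : realType) (n : nat) : {poly R} * {poly R} :=
  match n with
  | 0 => (1, 0)
  | k.+1 => ('X * (cheb R k).1 - (1 - 'X^2) * (cheb R k).2,
             'X * (cheb R k).2 + (cheb R k).1)
  end.

Definition chebT (R : realType) n : {poly R} := (cheb R n).1.
Definition chebV (R : realType) n : {poly R} := (cheb R n).2.

Lemma chebTS (R : realType) n :
  chebT R n.+1 = 'X * chebT R n - (1 - 'X^2) * chebV R n.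
Proof. by []. Qed.

Lemma chebVS (R : realType) n : chebV R n.+1 = 'X * chebV R n + chebT R n.
Proof. by []. Qed.

Lemma cheb_trig (R : realType) n (v : R) :
  (chebT R n).[cos v] = cos (n%:R * v) /\
  (chebV R n).[cos v] * sin v = sin (n%:R * v).
Proof.
elim: n => [|n [IT IV]].
  by rewrite mul0r cos0 sin0 /chebT /chebV /= !hornerE.
rewrite -natr1 mulrDl mul1r cosD sinD -IT -IV chebTS chebVS !hornerE.
split; last by ring.
have -> : 1 - cos v ^+ 2 = sin v ^+ 2 by rewrite sin2cos2.
by ring.
Qed.

Lemma chebT_cos (R : realType) n (v : R) : (chebT R n).[cos v] = cos (n%:R * v).
Proof. by case: (cheb_trig n v). Qed.

Lemma chebV_sin (R : realType) n (v : R) :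
  (chebV R n).[cos v] * sin v = sin (n%:R * v).
Proof. by case: (cheb_trig n v). Qed.

Lemma cheb_deriv (R : realType) n :
  (chebT R n)^`() = n%:R%:P * chebV R n /\
  (1 - 'X^2) * (chebV R n)^`() = 'X * chebV R n - n%:R%:P * chebT R n.
Proof.
elim: n => [|n [IT IV]].
  by rewrite /chebT /chebV /= derivC linear0 !mulr0 mul0r subr0.
rewrite chebTS chebVS !poly.derivE IT -natr1 polyCD polyC1.
split.
  have -> : (1 - 'X^2) * (chebV R n)^`() =
    'X * chebV R n - n%:R%:P * chebT R n by [].
  ring.
rewrite mulrDr mulrDr [_ * ('X * _)]mulrCA IV; ring.
Qed.

Lemma chebT_deriv (R : realType) n : (chebT R n)^`() = n%:R%:P * chebV R n.
Proof. by case: (cheb_deriv R n). Qed.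

Lemma cheb_pell (R : realType) n :
  chebT R n ^+ 2 + (1 - 'X^2) * chebV R n ^+ 2 = 1.
Proof.
elim: n => [|n IH]; first by rewrite /chebT /chebV /= expr0n/= mulr0 addr0 expr1n.
by rewrite chebTS chebVS -[RHS]IH; ring.
Qed.

Lemma cheb_pell_horner (R : realType) n (x : R) :
  (chebT R n).[x] ^+ 2 + (1 - x ^+ 2) * (chebV R n).[x] ^+ 2 = 1.
Proof. by have := congr1 (horner^~ x) (cheb_pell R n); rewrite !hornerE. Qed.

Lemma chebV_end (R : realType) n (x : R) : x ^+ 2 = 1 ->
  (chebV R n).[x] ^+ 2 = n%:R ^+ 2.
Proof.
move=> x1; have HP := cheb_pell_horner n x.
have [_ /(congr1 (horner^~ x))] := cheb_deriv R n.
rewrite !hornerE x1 subrr mul0r => /esym/eqP; rewrite subr_eq0 => /eqP E.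
rewrite x1 subrr mul0r addr0 in HP.
have -> : (chebV R n).[x] ^+ 2 = (x * (chebV R n).[x]) ^+ 2.
  by rewrite exprMn x1 mul1r.
by rewrite E exprMn HP mulr1.
Qed.

Lemma chebT_norm (R : realType) n (x : R) : x ^+ 2 <= 1 ->
  (chebT R n).[x] ^+ 2 <= 1.
Proof.
move=> x1; rewrite -(cheb_pell_horner n x) lerDl.
by rewrite mulr_ge0 ?sqr_ge0// subr_ge0.
Qed.

Lemma chebV_norm (R : realType) n (x : R) : x ^+ 2 <= 1 ->
  (chebV R n).[x] ^+ 2 <= n%:R ^+ 2.
Proof.
move=> x1; rewrite -ler_sqrt ?sqr_ge0// !sqrtr_sqr (ger0_norm (ler0n _ _)).
have n1 (y : R) : y ^+ 2 <= 1 -> `|y| <= 1 by move/abs_le_sqr; rewrite ler_norml.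
elim: n => [|n IH]; first by rewrite /chebV /= horner0 normr0.
rewrite chebVS !hornerE (le_trans (ler_normD _ _))// -natr1 lerD//.
  by rewrite normrM (le_trans _ IH)// ler_piMl// n1.
exact/n1/chebT_norm.
Qed.

(** * The weight concentrated at the ends *)

(** The factor V_p^2 / p^2 is 1 at both ends of [-1, 1] and has a double zero at
    each interior root of V_p; the power of X makes the rest of the interval
    negligible when M is large. *)
Definition weight (R : realType) (p M : nat) : {poly R} :=
  (p%:R ^- 2)%:P * (chebV R p ^+ 2 * 'X^(2 * M)).

Lemma weightE (R : realType) p M (x : R) :
  (weight R p M).[x] = (chebV R p).[x] ^+ 2 / p%:R ^+ 2 * x ^+ (2 * M).
Proof. by rewrite /weight hornerM hornerC hornerM hornerXn horner_exp; ring. Qed.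

Lemma weight_end (R : realType) p M (x : R) : (0 < p)%N -> x ^+ 2 = 1 ->
  (weight R p M).[x] = 1.
Proof.
move=> p0 x1; rewrite weightE chebV_end// exprM x1 expr1n mulr1 divff//.
by rewrite expf_neq0// pnatr_eq0 -lt0n.
Qed.

(** Thanks to this factorization (1 - weight) y^2 / (1 - xi^2) is polynomial,
    although y / sqrt(1 - xi^2) is not even defined at xi = 1 and xi = -1. *)
Lemma weight_cofactor (R : realType) p M : (0 < p)%N ->
  exists Q : {poly R}, 1 - weight R p M = Q * (1 - 'X^2).
Proof.
move=> p0; have rs : all (root (1 - weight R p M)) [:: 1; -1].
  rewrite /= !rootE !(hornerD, hornerN, hornerC) !weight_end ?expr1n ?sqrrN ?expr1n//.
  by rewrite subrr eqxx.
have us : uniq_roots [:: 1; -1 : R].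
  rewrite uniq_rootsE /= inE andbT -subr_eq0 opprK.
  by rewrite (_ : 1 + 1 = 2%:R) ?pnatr_eq0// .
have /dvdpP [Q EQ] := uniq_roots_dvdp rs us.
exists (- Q); rewrite EQ !big_cons big_nil mulr1 polyCN opprK polyC1; ring.
Qed.

Lemma weight_ge0 (R : realType) p M (x : R) : 0 <= (weight R p M).[x].
Proof. by rewrite weightE exprM mulr_ge0 ?divr_ge0 ?sqr_ge0//; apply: exprn_ge0; exact: sqr_ge0. Qed.

Lemma weight_le_exp (R : realType) p M (x : R) : x ^+ 2 <= 1 ->
  (weight R p M).[x] <= (x ^+ 2) ^+ M.
Proof.
move=> x1; have H : 0 <= (x ^+ 2) ^+ M by apply: exprn_ge0; exact: sqr_ge0.
rewrite weightE exprM ler_piMl//.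
have [->|p0] := posnP p; first by rewrite expr0n/= invr0 mulr0.
by rewrite ler_pdivrMr ?exprn_gt0 ?ltr0n// mul1r chebV_norm.
Qed.

Lemma weight_le1 (R : realType) p M (x : R) : x ^+ 2 <= 1 ->
  (weight R p M).[x] <= 1.
Proof.
by move=> x1; rewrite (le_trans (weight_le_exp p M x1))// exprn_ile1 ?sqr_ge0.
Qed.

Lemma weight_root (R : realType) p M (x : R) : (chebV R p).[x] = 0 ->
  (weight R p M).[x] = 0 /\ (weight R p M)^`().[x] = 0.
Proof.
move=> V0; split; first by rewrite weightE V0 expr0n/= mul0r mul0r.
rewrite /weight derivM derivC mul0r add0r derivM [_ ^+ 2]expr2 derivM.
by rewrite !(hornerM, hornerD) V0 !(mul0r, mulr0, addr0).
Qed.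

(** * The disk *)

Lemma chebV_neq0_end (R : realType) n (x : R) : (0 < n)%N -> x ^+ 2 = 1 ->
  (chebV R n).[x] != 0.
Proof.
move=> n0 /(chebV_end n) E; apply/eqP => V0; move: E; rewrite V0 expr0n/=.
by move/esym/eqP; rewrite expf_eq0/= pnatr_eq0 -leqn0 leqNgt n0.
Qed.

Lemma cos_param (R : realType) (x : R) : x ^+ 2 <= 1 ->
  exists v, 0 <= v <= pi /\ x = cos v.
Proof.
move=> /abs_le_sqr xb.
by exists (acos x); rewrite acos_ge0// acos_lepi// acosK.
Qed.

Lemma chebV_root (R : realType) n (v : R) : (0 < n)%N ->
  (chebV R n).[cos v] = 0 -> pimul (n%:R * v) /\ sin v != 0.
Proof.
move=> n0 V0; split; first by apply/sin_eq0P; rewrite -chebV_sin V0 mul0r.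
apply/eqP => s0; have /(chebV_neq0_end n0) : cos v ^+ 2 = 1.
  by rewrite cos2sin2 s0 expr0n subr0.
by rewrite V0 eqxx.
Qed.

Lemma chebV_coprime (R : realType) m n (x : R) : (0 < m)%N -> (0 < n)%N ->
  coprime m n -> x ^+ 2 <= 1 -> (chebV R m).[x] = 0 -> (chebV R n).[x] != 0.
Proof.
move=> m0 n0 co /cos_param [v [_ ->]] Vm; apply/eqP => Vn.
have [Hm s0] := chebV_root m0 Vm; have [Hn _] := chebV_root n0 Vn.
by have /sin_eq0P/eqP := pimul_coprime co Hm Hn; rewrite (negbTE s0).
Qed.

Lemma chebV_chebT_root (R : realType) m n (x : R) : (0 < m)%N -> (0 < n)%N ->
  coprime m n -> x ^+ 2 <= 1 -> (chebV R n).[x] = 0 ->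
  (chebV R n).[(chebT R m).[x]] = 0.
Proof.
move=> m0 n0 co x1 Vn; have Vm : (chebV R m).[x] != 0.
  by apply: chebV_coprime Vn => //; rewrite coprime_sym.
have [v [_ Ev]] := cos_param x1; subst x.
have [Hn s0] := chebV_root n0 Vn.
have := chebV_sin n (m%:R * v); rewrite mulrCA.
have /sin_eq0P -> := pimulMn m Hn; rewrite chebT_cos -chebV_sin => /eqP.
by rewrite mulf_eq0 mulf_eq0 (negbTE s0) (negbTE Vm) !orbF => /eqP.
Qed.

Section RibbonDisk.
Context (R : realType) (N q p M : nat) (cc sc : R) (Q : {poly R}).

(** On the disk put X = cos v and Y = l sin v with 0 <= v <= pi and |l| <= 1,
    and let theta = N v. Then [xiF] is cos theta, and [yF] is s sin theta
    where the signed radius s is affine in l and runs from minus the radius of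
    the knot at -v to the radius of the knot at v. [bF] interpolates the same
    two radii without the sign. The abscissa is cos theta times a smoothed
    square root of [tF], which is close to s^2 unless sin theta is small, and
    to the square of [bF] where sin theta is close to 0; this keeps the sheet
    immersed where sin theta = 0. On the boundary circle s^2 and the square of
    [bF] agree, so that all the choices made for [weight] and [prof] leave the
    boundary unchanged. *)
Definition xiF (X : R) : R := (chebT R N).[X].
Definition rF (X : R) : R := 2 + cc * (chebT R q).[X].
Definition wF (X : R) : R := sc * (chebV R q).[X].
Definition yF (X Y : R) : R := (chebV R N).[X] * (Y * rF X - wF X * (1 - X ^+ 2)).
Definition bF (X Y : R) : R := rF X - wF X * Y.
Definition tF (X Y : R) : R :=
  Q.[xiF X] * yF X Y ^+ 2 + (weight R p M).[xiF X] * bF X Y ^+ 2.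
Definition xF (X Y : R) : R := xiF X * Num.sqrt (prof (tF X Y)).
Definition zF (X : R) : R := (chebT R p).[X].

Definition gF (u : 'rV[R]_2) : 'rV[R]_3 :=
  \row_(i < 3) [:: xF (u 0 0) (u 0 1); yF (u 0 0) (u 0 1); zF (u 0 0)]`_i.

Lemma smv_gF : smv gF.
Proof.
have SX : sm (fun u : 'rV[R]_2 => u 0 0) by exact: sm_coord.
have SY : sm (fun u : 'rV[R]_2 => u 0 1) by exact: sm_coord.
have Sc c : sm (fun _ : 'rV[R]_2 => c) by exact: sm_const.
have Sxi : sm (fun u : 'rV[R]_2 => xiF (u 0 0)) by exact: sm_horner.
have Sr : sm (fun u : 'rV[R]_2 => rF (u 0 0)).
  by apply: sm_add => //; apply: sm_mul => //; exact: sm_horner.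
have Sw : sm (fun u : 'rV[R]_2 => wF (u 0 0)).
  by apply: sm_mul => //; exact: sm_horner.
have Sy : sm (fun u : 'rV[R]_2 => yF (u 0 0) (u 0 1)).
  apply: sm_mul; first exact: sm_horner.
  apply: sm_sub; first exact: sm_mul.
  apply: sm_mul => //; apply: sm_sub => //; exact: sm_exp.
have Sb : sm (fun u : 'rV[R]_2 => bF (u 0 0) (u 0 1)).
  by apply: sm_sub => //; exact: sm_mul.
have St : sm (fun u : 'rV[R]_2 => tF (u 0 0) (u 0 1)).
  by apply: sm_add; apply: sm_mul; [exact: sm_horner|exact: sm_exp|
    exact: sm_horner|exact: sm_exp].
apply: row3P.
- rewrite (_ : (fun _ => _) = fun u : 'rV[R]_2 => xF (u 0 0) (u 0 1)).
    by apply: sm_mul => //; apply: sm_sqrt => [|u]; [exact: sm_prof|exact: prof_gt0].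
  by rewrite funeqE => u; rewrite mxE.
- rewrite (_ : (fun _ => _) = fun u : 'rV[R]_2 => yF (u 0 0) (u 0 1)) //.
  by rewrite funeqE => u; rewrite mxE.
- rewrite (_ : (fun _ => _) = fun u : 'rV[R]_2 => zF (u 0 0)); first exact: sm_horner.
  by rewrite funeqE => u; rewrite mxE.
Qed.

Lemma is_derive_horner0 (P : {poly R}) (u v : 'rV[R]_2) :
  is_derive u v (fun x => P.[x 0 0]) (P^`().[u 0 0] * v 0 0).
Proof. exact: (is_derive_comp1 (is_derive_coord u v 0) (is_derive_poly P _)). Qed.

Lemma is_derive_xi (u v : 'rV[R]_2) :
  is_derive u v (fun x => xiF (x 0 0)) (N%:R * (chebV R N).[u 0 0] * v 0 0).
Proof.
have := is_derive_horner0 (chebT R N) u v.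
by rewrite chebT_deriv hornerM hornerC.
Qed.

Lemma is_derive_z (u v : 'rV[R]_2) :
  is_derive u v (fun x => zF (x 0 0)) (p%:R * (chebV R p).[u 0 0] * v 0 0).
Proof.
have := is_derive_horner0 (chebT R p) u v.
by rewrite chebT_deriv hornerM hornerC.
Qed.

Lemma is_derive_y (u : 'rV[R]_2) : exists c, forall v,
  is_derive u v (fun x => yF (x 0 0) (x 0 1))
    (c * v 0 0 + (chebV R N).[u 0 0] * rF (u 0 0) * v 0 1).
Proof.
pose Pr : {poly R} := 2%:P + cc%:P * chebT R q.
pose Pw : {poly R} := sc%:P * chebV R q * (1 - 'X^2).
have Er X : rF X = Pr.[X] by rewrite /rF /Pr !hornerE.
have Ew X : wF X * (1 - X ^+ 2) = Pw.[X] by rewrite /wF /Pw !hornerE.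
exists ((chebV R N)^`().[u 0 0] * (u 0 1 * Pr.[u 0 0] - Pw.[u 0 0]) +
   (chebV R N).[u 0 0] * (u 0 1 * Pr^`().[u 0 0] - Pw^`().[u 0 0])) => v.
have D1 := is_deriveM (is_derive_coord u v 1) (is_derive_horner0 Pr u v).
have D2 := is_deriveM (is_derive_horner0 (chebV R N) u v)
  (is_deriveB D1 (is_derive_horner0 Pw u v)).
rewrite (_ : (fun _ => _) = (fun x : 'rV[R]_2 => (chebV R N).[x 0 0]) *
  ((fun x : 'rV[R]_2 => x 0 1) * (fun x : 'rV[R]_2 => Pr.[x 0 0]) -
   (fun x : 'rV[R]_2 => Pw.[x 0 0]))); last first.
  by rewrite funeqE => x; rewrite /yF Er Ew.
apply: (is_derive_eq D2); rewrite Er !fctE /GRing.scale /=; ring.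
Qed.

Lemma is_derive_b (u : 'rV[R]_2) : exists c, forall v,
  is_derive u v (fun x => bF (x 0 0) (x 0 1)) (c * v 0 0 - wF (u 0 0) * v 0 1).
Proof.
pose Pr : {poly R} := 2%:P + cc%:P * chebT R q.
pose Pw : {poly R} := sc%:P * chebV R q.
have Er X : rF X = Pr.[X] by rewrite /rF /Pr !hornerE.
have Ew X : wF X = Pw.[X] by rewrite /wF /Pw !hornerE.
exists (Pr^`().[u 0 0] - Pw^`().[u 0 0] * u 0 1) => v.
have D1 := is_deriveM (is_derive_horner0 Pw u v) (is_derive_coord u v 1).
have D2 := is_deriveB (is_derive_horner0 Pr u v) D1.
rewrite (_ : (fun _ => _) = (fun x : 'rV[R]_2 => Pr.[x 0 0]) -
  ((fun x : 'rV[R]_2 => Pw.[x 0 0]) * (fun x : 'rV[R]_2 => x 0 1))); last first.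
  by rewrite funeqE => x; rewrite /bF Er Ew.
apply: (is_derive_eq D2); rewrite Ew /GRing.scale /=; ring.
Qed.

Lemma is_derive_t (u v : 'rV[R]_2) dy db :
  is_derive u v (fun x => yF (x 0 0) (x 0 1)) dy ->
  is_derive u v (fun x => bF (x 0 0) (x 0 1)) db ->
  let xi := xiF (u 0 0) in let W := weight R p M in
  let y := yF (u 0 0) (u 0 1) in let b := bF (u 0 0) (u 0 1) in
  let dxi := N%:R * (chebV R N).[u 0 0] * v 0 0 in
  is_derive u v (fun x => tF (x 0 0) (x 0 1))
    (Q^`().[xi] * dxi * y ^+ 2 + 2 * Q.[xi] * y * dy +
     (W^`().[xi] * dxi * b ^+ 2 + 2 * W.[xi] * b * db)).
Proof.
move=> Dy Db xi W y b dxi.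
have DQ := is_derive_comp1 (is_derive_xi u v) (is_derive_poly Q _).
have DW := is_derive_comp1 (is_derive_xi u v) (is_derive_poly W _).
have D1 := is_deriveM DQ (is_deriveM Dy Dy).
have D2 := is_deriveM DW (is_deriveM Db Db).
apply: (is_derive_eq (is_deriveD D1 D2)).
by rewrite !fctE /GRing.scale /= -/W -/xi -/dxi -/y -/b; ring.
Qed.

Definition sigma (X Y : R) : R := Num.sqrt (prof (tF X Y)).
Definition dsigma (X Y : R) : R := dprof (tF X Y) / (2 * sigma X Y).

Lemma is_derive_x (u v : 'rV[R]_2) dt :
  is_derive u v (fun x => tF (x 0 0) (x 0 1)) dt ->
  is_derive u v (fun x => xF (x 0 0) (x 0 1))
    (N%:R * (chebV R N).[u 0 0] * v 0 0 * sigma (u 0 0) (u 0 1) +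
     xiF (u 0 0) * (dsigma (u 0 0) (u 0 1) * dt)).
Proof.
move=> Dt; have D1 := is_derive_comp1 Dt (is_derive_prof _).
have D2 := is_derive_comp1 D1 (is_derive1_sqrt (prof_gt0 _)).
apply: (is_derive_eq (is_deriveM (is_derive_xi u v) D2)).
by rewrite /GRing.scale /= /dsigma /sigma; ring.
Qed.

End RibbonDisk.

(** * Immersion and transversality *)

Section Differential.
Context (R : realType) (N q p M : nat) (cc sc : R) (Q : {poly R}).
Context (N_gt0 : (0 < N)%N) (q_gt0 : (0 < q)%N) (p_gt0 : (0 < p)%N).
Context (coNq : coprime N q) (coNp : coprime N p).
Context (ccsc : cc ^+ 2 + sc ^+ 2 = 1) (scN : (1 < N)%N -> sc != 0).
Context (QE : 1 - weight R p M = Q * (1 - 'X^2)).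

Local Notation gF := (gF N q p M cc sc Q).
Local Notation xF := (xF N q p M cc sc Q).
Local Notation yF := (yF N q cc sc).
Local Notation bF := (bF q cc sc).
Local Notation tF := (tF N q p M cc sc Q).
Local Notation sigma := (sigma N q p M cc sc Q).
Local Notation dsigma := (dsigma N q p M cc sc Q).

(** Cauchy-Schwarz, with T^2 + (1 - X^2) V^2 = 1 and cc^2 + sc^2 = 1. *)
Lemma bF_itv X Y : X ^+ 2 + Y ^+ 2 <= 1 -> 1 <= bF X Y <= 3.
Proof.
move=> XY; pose T := (chebT R q).[X]; pose V := (chebV R q).[X].
have HP : T ^+ 2 + (1 - X ^+ 2) * V ^+ 2 = 1 by exact: cheb_pell_horner.
have H : (cc * T - sc * V * Y) ^+ 2 <= 1.
  have E : (cc ^+ 2 + sc ^+ 2) * (T ^+ 2 + (1 - X ^+ 2) * V ^+ 2) -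
    (cc * T - sc * V * Y) ^+ 2 =
    (cc ^+ 2 + sc ^+ 2) * (1 - X ^+ 2 - Y ^+ 2) * V ^+ 2 + (cc * (V * Y) + sc * T) ^+ 2.
    by ring.
  rewrite ccsc HP !mul1r in E; rewrite -subr_ge0 E addr_ge0 ?sqr_ge0//.
  by rewrite mulr_ge0 ?sqr_ge0//; lra.
move/abs_le_sqr: H; rewrite /bF /rF /wF -/T -/V => /andP[H1 H2].
by apply/andP; split; lra.
Qed.

Lemma rF_ge1 X : X ^+ 2 <= 1 -> 1 <= rF q cc X.
Proof.
move=> X1; have : 1 <= bF X 0 <= 3 by rewrite bF_itv// expr0n addr0.
by rewrite /bF mulr0 subr0 => /andP[].
Qed.

Lemma gF_D (u v : 'rV[R]_2) dx dy dz :
  is_derive u v (fun w => xF (w 0 0) (w 0 1)) dx ->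
  is_derive u v (fun w => yF (w 0 0) (w 0 1)) dy ->
  is_derive u v (fun w => zF p (w 0 0)) dz ->
  [/\ ('D_v gF u) 0 0 = dx, ('D_v gF u) 0 1 = dy & ('D_v gF u) 0 2%:R = dz].
Proof.
move=> [_ <-] [_ <-] [_ <-]; have S := smv_gF N q p M cc sc Q.
by split; rewrite (smv_deriveE _ _ _ S); congr ('D_v _ u);
   rewrite funeqE => w; rewrite mxE.
Qed.

Lemma weight_flat xi : xi ^+ 2 <= 1 -> (chebV R p).[xi] = 0 ->
  [/\ (weight R p M).[xi] = 0, (weight R p M)^`().[xi] = 0,
      Q.[xi] * (1 - xi ^+ 2) = 1, 0 <= Q.[xi] & 0 <= xi * Q^`().[xi]].
Proof.
move=> xi1 V0; have [W0 W1] := weight_root M V0.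
have E : Q.[xi] * (1 - xi ^+ 2) = 1.
  have := congr1 (horner^~ xi) QE.
  by rewrite /= hornerM !hornerD !hornerN !hornerXn hornerC W0 subr0 => <-.
have D : Q^`().[xi] * (1 - xi ^+ 2) = 2 * xi * Q.[xi].
  move: QE W1; move: (weight R p M) => W /(congr1 (fun P : {poly R} => P^`().[xi])).
  rewrite /= !poly.derivE !hornerE => + W1; rewrite W1 oppr0 => /esym.
  by move=> e0; apply/eqP; rewrite -subr_eq0 -e0; apply/eqP; ring.
have p1 : 0 < 1 - xi ^+ 2.
  rewrite lt_neqAle subr_ge0 xi1 andbT eq_sym.
  by apply/eqP => e0; move: E; rewrite e0 mulr0 => /esym/eqP; rewrite oner_eq0.
have q0 : 0 <= Q.[xi] by rewrite -(pmulr_lge0 _ p1) E.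
split=> //; rewrite -(pmulr_lge0 _ p1) -mulrA D.
have -> : xi * (2 * xi * Q.[xi]) = 2 * xi ^+ 2 * Q.[xi] by ring.
by rewrite mulr_ge0// mulr_ge0 ?sqr_ge0.
Qed.

(** At the double zeros of the weight the abscissa depends, to first order, on
    xi and y only; [slope_xi] and [slope_y] are its partial derivatives there. *)
Definition sigma0 (xi y : R) : R := Num.sqrt (prof (Q.[xi] * y ^+ 2)).
Definition slope_xi (xi y : R) : R :=
  sigma0 xi y + dprof (Q.[xi] * y ^+ 2) / (2 * sigma0 xi y) *
  (xi * Q^`().[xi] * y ^+ 2).
Definition slope_y (xi y : R) : R :=
  xi * (dprof (Q.[xi] * y ^+ 2) / (2 * sigma0 xi y)) * (2 * Q.[xi] * y).

Lemma tF_flat X Y : xiF N X ^+ 2 <= 1 -> (chebV R p).[xiF N X] = 0 ->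
  tF X Y = Q.[xiF N X] * yF X Y ^+ 2.
Proof.
by move=> x1 V0; have [W0 _ _ _ _] := weight_flat x1 V0; rewrite /tF W0 mul0r addr0.
Qed.

Lemma slope_xi_gt0 xi y : xi ^+ 2 <= 1 -> (chebV R p).[xi] = 0 ->
  0 < slope_xi xi y.
Proof.
move=> x1 V0; have [_ _ _ _ H] := weight_flat x1 V0.
have s0 : 0 < sigma0 xi y by rewrite sqrtr_gt0 prof_gt0.
have h1 : 0 <= xi * Q^`().[xi] * y ^+ 2 by rewrite mulr_ge0 ?sqr_ge0.
have h2 : 0 <= dprof (Q.[xi] * y ^+ 2) / (2 * sigma0 xi y).
  by rewrite divr_ge0 ?dprof_ge0// mulr_ge0// ltW.
by rewrite ltr_wpDr// mulr_ge0.
Qed.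

Lemma is_derive_x_flat (u v : 'rV[R]_2) dy :
  xiF N (u 0 0) ^+ 2 <= 1 -> (chebV R p).[xiF N (u 0 0)] = 0 ->
  is_derive u v (fun w => yF (w 0 0) (w 0 1)) dy ->
  let xi := xiF N (u 0 0) in let y := yF (u 0 0) (u 0 1) in
  is_derive u v (fun w => xF (w 0 0) (w 0 1))
    (N%:R * (chebV R N).[u 0 0] * v 0 0 * slope_xi xi y + slope_y xi y * dy).
Proof.
move=> x1 V0 Dy xi y; have [W0 W1 _ _ _] := weight_flat x1 V0.
have [c Db] := is_derive_b q cc sc u.
have Dt := is_derive_t p M Q Dy (Db v).
apply: (is_derive_eq (is_derive_x Dt)).
rewrite /slope_xi /slope_y /sigma0 /dsigma /sigma tF_flat// W0 W1 -/xi -/y.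
by ring.
Qed.

(** Where V_p(X) <> 0 the height moves with X, so only the direction of Y is in
    question: it moves y unless sin theta = 0, and there the weight is 1 and it
    moves the abscissa, at a speed proportional to sc. Where V_p(X) = 0 the
    height is stationary, but the weight vanishes to second order and (xi, y)
    are local coordinates of the horizontal plane. *)
Lemma gF_immersion (u v : 'rV[R]_2) :
  u 0 0 ^+ 2 + u 0 1 ^+ 2 <= 1 -> 'D_v gF u = 0 -> v = 0.
Proof.
move=> u1 D0; set X := u 0 0; set Y := u 0 1.
have X1 : X ^+ 2 <= 1 by rewrite (le_trans _ u1)// lerDl sqr_ge0.
have xi1 : xiF N X ^+ 2 <= 1 by exact: chebT_norm.
have r1 := rF_ge1 X1.
have r0 : rF q cc X != 0 by rewrite gt_eqF// (lt_le_trans ltr01).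
have pn : p%:R != 0 :> R by rewrite pnatr_eq0 -lt0n.
have Nn : N%:R != 0 :> R by rewrite pnatr_eq0 -lt0n.
suff [a0 b0] : v 0 0 = 0 /\ v 0 1 = 0.
  apply/rowP => i; rewrite mxE; case: i => -[|[|//]] Hi.
    by rewrite -[RHS]a0; congr (v _ _); apply: val_inj.
  by rewrite -[RHS]b0; congr (v _ _); apply: val_inj.
have [c Dy] := is_derive_y N q cc sc u.
have [cb Db] := is_derive_b q cc sc u.
have Dt := is_derive_t p M Q (Dy v) (Db v).
have [Ex Ey Ez] := gF_D (is_derive_x Dt) (Dy v) (is_derive_z p u v).
rewrite D0 mxE -/X in Ex; rewrite D0 mxE -/X in Ey; rewrite D0 mxE -/X in Ez.
have [Vp|Vp] := eqVneq (chebV R p).[X] 0.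
  have VN : (chebV R N).[X] != 0 by apply: chebV_coprime Vp => //; rewrite coprime_sym.
  have Vx : (chebV R p).[xiF N X] = 0 by exact: chebV_chebT_root.
  have Dx := is_derive_x_flat xi1 Vx (Dy v).
  have [Ex2 _ _] := gF_D Dx (Dy v) (is_derive_z p u v).
  rewrite D0 mxE -/X -Ey mulr0 addr0 in Ex2.
  have a0 : v 0 0 = 0.
    move/esym/eqP: Ex2; rewrite mulf_eq0 (gt_eqF (slope_xi_gt0 _ xi1 Vx)) orbF.
    by rewrite !mulf_eq0 (negbTE Nn) (negbTE VN) => /eqP.
  split=> //; move/esym/eqP: Ey; rewrite a0 mulr0 add0r !mulf_eq0.
  by rewrite (negbTE VN) (negbTE r0) => /eqP.
have a0 : v 0 0 = 0.
  by move/esym/eqP: Ez; rewrite !mulf_eq0 (negbTE pn) (negbTE Vp) => /eqP.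
split=> //; move/esym/eqP: Ey; rewrite a0 mulr0 add0r !mulf_eq0 (negbTE r0) orbF.
case/orP => [/eqP VN|/eqP//].
have N1 : (1 < N)%N.
  rewrite ltn_neqAle N_gt0 andbT; apply/eqP => N1; move: VN; rewrite -N1.
  rewrite /chebV /= mulr0 add0r hornerC => /eqP.
  by rewrite oner_eq0.
have Vq : (chebV R q).[X] != 0 by exact: chebV_coprime VN.
have xi2 : xiF N X ^+ 2 = 1.
  by have := cheb_pell_horner N X; rewrite VN expr0n mulr0 addr0.
have /andP[b1 _] := bF_itv u1; rewrite -/X -/Y in b1.
have y0 : yF X Y = 0 by rewrite /yF VN mul0r.
have Et : tF X Y = bF X Y ^+ 2.
  by rewrite /tF y0 weight_end// expr0n mulr0 add0r mul1r.
have t1 : 1 <= tF X Y by rewrite Et exprn_ege1.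
have b0 : bF X Y != 0 by rewrite gt_eqF// (lt_le_trans ltr01).
have Es : sigma X Y = bF X Y.
  by rewrite /sigma prof_id// Et sqrtr_sqr ger0_norm// (le_trans ler01).
move/esym/eqP: Ex; rewrite a0 !(mulr0, mul0r, add0r) -/Y y0 !(mulr0, mul0r, add0r).
rewrite weight_end// /dsigma dprof1// -/(sigma X Y) Es.
have -> : 1 / (2 * bF X Y) * (2 * 1 * bF X Y * - (wF q sc X * v 0 1)) =
  - (wF q sc X * v 0 1) by field.
have xn : xiF N X != 0 by apply/eqP => e0; move/eqP: xi2; rewrite e0 expr0n eq_sym oner_eq0.
rewrite !(mulf_eq0, oppr_eq0) (negbTE xn) (negbTE Vq) (negbTE (scN N1)) /=.
by move/eqP.
Qed.

(** The two sheets have the same partial derivatives in xi and y, so both tangent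
    planes contain the direction of y at constant xi. Moving xi at constant y
    changes the heights of the two sheets at rates V_p(X1) / V_N(X1) and
    V_p(X2) / V_N(X2), up to a common factor; these are assumed to differ. *)
Lemma gF_transverse (u1 u2 : 'rV[R]_2) (k : 'cV[R]_3) :
  let X1 := u1 0 0 in let X2 := u2 0 0 in
  X1 ^+ 2 <= 1 -> xiF N X1 = xiF N X2 ->
  yF X1 (u1 0 1) = yF X2 (u2 0 1) -> (chebV R p).[xiF N X1] = 0 ->
  (chebV R N).[X1] != 0 ->
  (chebV R N).[X1] * (chebV R p).[X2] != (chebV R N).[X2] * (chebV R p).[X1] ->
  'J gF u1 *m k = 0 -> 'J gF u2 *m k = 0 -> k = 0.
Proof.
move=> X1 X2 hX1 Exi Ey Vx VN det J1 J2.
have S := smv_gF N q p M cc sc Q.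
have xi1 : xiF N X1 ^+ 2 <= 1 by exact: chebT_norm.
have pn : p%:R != 0 :> R by rewrite pnatr_eq0 -lt0n.
have Nn : N%:R != 0 :> R by rewrite pnatr_eq0 -lt0n.
set xi := xiF N X1 in Vx xi1; set y := yF X1 (u1 0 1) in Ey.
have key (u v : 'rV[R]_2) : 'J gF u *m k = 0 -> xiF N (u 0 0) = xi ->
   yF (u 0 0) (u 0 1) = y -> exists c,
   let dy := c * v 0 0 + (chebV R N).[u 0 0] * rF q cc (u 0 0) * v 0 1 in
   (N%:R * (chebV R N).[u 0 0] * v 0 0 * slope_xi xi y + slope_y xi y * dy) * k 0 0
   + dy * k 1 0 + p%:R * (chebV R p).[u 0 0] * v 0 0 * k 2%:R 0 = 0.
  move=> J0 Ex Ey'; have [c Dy] := is_derive_y N q cc sc u.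
  exists c => dy.
  have Dx : is_derive u v (fun w => xF (w 0 0) (w 0 1))
    (N%:R * (chebV R N).[u 0 0] * v 0 0 * slope_xi xi y + slope_y xi y * dy).
    by have := @is_derive_x_flat u v _ _ _ (Dy v); rewrite Ex Ey'; apply.
  have [E1 E2 E3] := gF_D Dx (Dy v) (is_derive_z p u v).
  have : ('D_v gF u *m k) 0 0 = 0.
    have -> : 'D_v gF u = v *m 'J gF u.
      exact: deriveEjacobian (smv_differentiable S u).
    by rewrite -mulmxA J0 mulmx0 mxE.
  rewrite mxE !big_ord_recl big_ord0 addr0 -E1 -E3 addrA -[dy]E2 => <-.
  congr (_ + _ + _); congr (_ * _);
  by [congr ('D_v gF u _ _); apply: val_inj|congr (k _ _); apply: val_inj].
have rX := rF_ge1 hX1.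
have r0 : rF q cc X1 != 0 by rewrite gt_eqF// (lt_le_trans ltr01).
have s0 := slope_xi_gt0 y xi1 Vx.
pose e1 : 'rV[R]_2 := delta_mx 0 0; pose e2 : 'rV[R]_2 := delta_mx 0 1.
have [c0 /=] := key u1 e2 J1 erefl erefl.
rewrite !mxE /= !(mulr0, mulr1, mul0r, add0r, addr0) => H2.
have V1 : (chebV R N).[X1] * rF q cc X1 != 0 by rewrite mulf_neq0.
have K2 : k 1 0 = - (slope_y xi y * k 0 0).
  apply/eqP; rewrite -addr_eq0; apply/eqP/(mulfI V1); rewrite mulr0 -[RHS]H2.
  by ring.
have K3 (u : 'rV[R]_2) : 'J gF u *m k = 0 -> xiF N (u 0 0) = xi ->
    yF (u 0 0) (u 0 1) = y ->
    N%:R * (chebV R N).[u 0 0] * slope_xi xi y * k 0 0 +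
    p%:R * (chebV R p).[u 0 0] * k 2%:R 0 = 0.
  move=> J0 Ex Ey'; have [c /=] := key u e1 J0 Ex Ey'.
  by rewrite !mxE /= K2 => E; rewrite -[RHS]E; ring.
have F1 := K3 u1 J1 erefl erefl; have F2 := K3 u2 J2 (esym Exi) (esym Ey).
rewrite -/X1 in F1; rewrite -/X2 in F2.
have dn : (chebV R N).[X1] * (chebV R p).[X2] -
  (chebV R N).[X2] * (chebV R p).[X1] != 0 by rewrite subr_eq0.
have k0 : k 0 0 = 0.
  apply/(mulfI dn)/(mulfI (lt0r_neq0 s0))/(mulfI Nn); rewrite !mulr0.
  transitivity (0 * (chebV R p).[X2] - 0 * (chebV R p).[X1] : R); last by ring.
  by rewrite -{1}F1 -F2; ring.
have k2 : k 2%:R 0 = 0.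
  have nz : (chebV R p).[X1] != 0 \/ (chebV R p).[X2] != 0.
    apply/orP; rewrite -negb_and; apply/negP => /andP[/eqP h1 /eqP h2].
    by move: det; rewrite h1 h2 !mulr0 eqxx.
  rewrite k0 mulr0 add0r in F1; rewrite k0 mulr0 add0r in F2.
  by case: nz => nz; apply/(mulfI nz)/(mulfI pn); rewrite !mulr0 mulrA.
have k1 : k 1 0 = 0 by rewrite K2 k0 mulr0 oppr0.
apply/colP => i; rewrite mxE; case: i => -[|[|[|//]]] Hi.
- by rewrite -[RHS]k0; congr (k _ _); apply: val_inj.
- by rewrite -[RHS]k1; congr (k _ _); apply: val_inj.
- by rewrite -[RHS]k2; congr (k _ _); apply: val_inj.
Qed.

End Differential.

(** * Strands over different angles do not meet *)

Lemma sqrt_prof_half (R : realType) (t : R) : 2^-1 <= Num.sqrt (prof t).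
Proof.
have -> : 2^-1 = Num.sqrt (4^-1) :> R.
  by have -> : 4^-1 = 2^-1 ^+ 2 :> R; [field|rewrite sqrtr_sqr ger0_norm].
by rewrite ler_sqrt ?prof_ge// ltW// prof_gt0.
Qed.

(** Two arcs at one height, at angles with cosines C and C' (up to sign) and
    C' < C, reach the same y at signed radii s and s'. If the first angle is
    close to 0 modulo pi, then y is small, hence so is s', and the second arc is
    in the range where its abscissa is C' / 2, the least possible factor. *)
Lemma radial_gap_end (R : realType) (M : nat) (S eta a d h C C' s s' b' W' t : R) :
  0 < S -> S <= 1 -> eta = (1 - (S / 9) ^+ 2) ^+ M -> eta <= 100^-1 ->
  S <= d -> 0 <= h -> h <= S / 9 -> h ^+ 2 = 1 - C ^+ 2 -> d <= h + a ->
  0 <= C' -> C' < C -> C <= 1 -> C - C' = 2 * a * d ->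
  s ^+ 2 <= 9 -> b' ^+ 2 <= 9 -> 0 <= W' -> W' <= (C' ^+ 2) ^+ M ->
  (1 - C ^+ 2) * s ^+ 2 = (1 - C' ^+ 2) * s' ^+ 2 ->
  C' * Num.sqrt (prof ((1 - W') * s' ^+ 2 + W' * b' ^+ 2)) <
  C * Num.sqrt (prof t).
Proof.
move=> S0 S1 Eeta eta1 Sd h0 hd Eh dha C'0 CC C1 EC s9 b9 W0 WM Ey.
have S9 : 0 <= S / 9 by rewrite divr_ge0// ltW.
have s'0 := sqr_ge0 s'; have b'0 := sqr_ge0 b'.
have D1 : S ^+ 2 <= C - C'.
  have a1 : S * (8 / 9) <= a by lra.
  have : S * (8 / 9) * S <= a * d by apply: ler_pM; lra.
  by rewrite EC expr2; nra.
have C'S : C' ^+ 2 <= 1 - S ^+ 2.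
  have : C' * C' <= 1 * C' by rewrite ler_wpM2r//; lra.
  by rewrite expr2; lra.
have s'1 : s' ^+ 2 <= 9^-1.
  have H : S ^+ 2 * s' ^+ 2 <= (1 - C' ^+ 2) * s' ^+ 2 by rewrite ler_wpM2r//; lra.
  have H2 : h ^+ 2 * s ^+ 2 <= (S / 9) ^+ 2 * 9.
    by apply: ler_pM; rewrite ?sqr_ge0// lerXn2r ?nnegrE.
  rewrite -Ey -Eh in H; rewrite -(ler_pM2l (exprn_gt0 2 S0)).
  by apply: (le_trans H); apply: (le_trans H2); rewrite expr_div_n; lra.
have S2 : (S / 9) ^+ 2 <= S ^+ 2 by rewrite lerXn2r ?nnegrE//; lra.
have We : W' <= 100^-1.
  apply: (le_trans WM); apply: (le_trans _ eta1); rewrite Eeta.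
  have C'2 := sqr_ge0 C'; rewrite lerXn2r ?nnegrE//; lra.
rewrite [X in C' * X](_ : _ = Num.sqrt 4^-1); last first.
  rewrite prof_quarter//.
  have A1 : (1 - W') * s' ^+ 2 <= 1 * 9^-1 by apply: ler_pM => //; lra.
  have A2 : W' * b' ^+ 2 <= 100^-1 * 9 by apply: ler_pM.
  by lra.
apply: (@lt_le_trans _ _ (C * Num.sqrt 4^-1)).
  by rewrite ltr_pM2r// sqrtr_gt0 invr_gt0.
have C0 : 0 < C by rewrite (le_lt_trans C'0).
by rewrite ler_pM2l// ler_sqrt ?prof_ge// ltW// prof_gt0.
Qed.

(** Away from the ends both weights are at most a small multiple of
    (C - C')^2. Without them s'^2 <= s^2 would decide the comparison; since
    [prof] is Lipschitz, they change the abscissas by an amount quadratic in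
    C - C', which cannot make up for the linear gain C - C'. *)
Lemma radial_gap_middle (R : realType) (M : nat)
    (L S eta h C C' s s' b b' W W' : R) :
  (forall x y, 0 <= x -> x <= y -> y <= 9 -> prof y <= prof x + L * (y - x)) ->
  1 <= L -> 0 < S -> eta = (1 - (S / 9) ^+ 2) ^+ M -> (S / 9) ^+ 2 <= 1 ->
  36 * L * eta < S ^+ 4 -> S / 9 < h -> h ^+ 2 = 1 - C ^+ 2 ->
  0 <= C' -> C' < C -> C <= 1 ->
  s ^+ 2 <= 9 -> s' ^+ 2 <= 9 -> b' ^+ 2 <= 9 ->
  (1 - C ^+ 2) * s ^+ 2 = (1 - C' ^+ 2) * s' ^+ 2 ->
  0 <= W -> W <= 1 -> 0 <= W' -> W' <= 1 ->
  S ^+ 4 * W <= (C - C') ^+ 2 * (C ^+ 2) ^+ M ->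
  S ^+ 4 * W' <= (C - C') ^+ 2 * (C' ^+ 2) ^+ M ->
  C' * Num.sqrt (prof ((1 - W') * s' ^+ 2 + W' * b' ^+ 2)) <
  C * Num.sqrt (prof ((1 - W) * s ^+ 2 + W * b ^+ 2)).
Proof.
move=> HL L1 S0 Eeta S9 eta2 hd Eh C'0 CC C1 s9 s'9 b9 Ey W0 W1 W'0 W'1 HW HW'.
have S4 : 0 < S ^+ 4 by rewrite exprn_gt0.
have h0 : 0 < h by rewrite (le_lt_trans _ hd)// divr_ge0// ltW.
have h2 : 0 < 1 - C ^+ 2 by rewrite -Eh exprn_gt0.
have C0 : 0 <= C by rewrite (le_trans C'0)// ltW.
have C2 : C' ^+ 2 <= C ^+ 2 by rewrite lerXn2r ?nnegrE// ltW.
have C'2 := sqr_ge0 C'; have s0 := sqr_ge0 s; have s'0 := sqr_ge0 s'.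
have b0 := sqr_ge0 b.
have CM : (C ^+ 2) ^+ M <= eta.
  have : (S / 9) ^+ 2 <= h ^+ 2 by rewrite lerXn2r ?nnegrE ?divr_ge0// ltW.
  by rewrite Eh Eeta => H; rewrite lerXn2r ?nnegrE; lra.
have C'M : (C' ^+ 2) ^+ M <= eta.
  by apply: (le_trans _ CM); rewrite lerXn2r ?nnegrE//; lra.
set t := (1 - W) * s ^+ 2 + _; set t' := (1 - W') * s' ^+ 2 + _.
pose De := C - C'; have De0 : 0 < De by rewrite subr_gt0.
pose w := De ^+ 2 * eta / S ^+ 4.
have Ww : W <= w.
  by rewrite /w ler_pdivlMr// mulrC (le_trans HW)// ler_wpM2l ?sqr_ge0.
have W'w : W' <= w.
  by rewrite /w ler_pdivlMr// mulrC (le_trans HW')// ler_wpM2l ?sqr_ge0.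
have w0 : 0 <= w by rewrite (le_trans W0).
have t't : t' <= t + 18 * w.
  have ss' : s' ^+ 2 <= s ^+ 2 by rewrite -(ler_pM2l h2) Ey ler_wpM2r//; lra.
  have A1 : W' * b' ^+ 2 <= w * 9 by apply: ler_pM => //; exact: sqr_ge0.
  have A2 : W * s ^+ 2 <= w * 9 by apply: ler_pM.
  have A3 : 0 <= W' * s' ^+ 2 by rewrite mulr_ge0.
  have A4 : 0 <= W * b ^+ 2 by rewrite mulr_ge0.
  by rewrite /t /t' !mulrBl !mul1r; lra.
have t0 : 0 <= t by rewrite addr_ge0// mulr_ge0// subr_ge0.
have t'9 : t' <= 9.
  have A1 : (1 - W') * s' ^+ 2 <= (1 - W') * 9 by rewrite ler_wpM2l ?subr_ge0.
  have A2 : W' * b' ^+ 2 <= W' * 9 by rewrite ler_wpM2l.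
  by rewrite /t'; lra.
have Lw : 0 <= L * w by rewrite mulr_ge0// (le_trans ler01).
have uu' : Num.sqrt (prof t') <= Num.sqrt (prof t) + 18 * (L * w).
  have [tt|tt] := leP t' t.
    rewrite (@le_trans _ _ (Num.sqrt (prof t)))// ?ler_sqrt ?le_prof//.
      by rewrite ltW// prof_gt0.
    by rewrite lerDl mulr_ge0.
  have H : prof t' <= prof t + 18 * (L * w).
    apply: (le_trans (HL _ _ t0 (ltW tt) t'9)).
    have L0 : 0 <= L by rewrite (le_trans ler01).
    by rewrite lerD2l mulrCA ler_wpM2l// lerBlDl.
  have u2 x : Num.sqrt (prof x) ^+ 2 = prof x :> R.
    by rewrite sqr_sqrtr// ltW// prof_gt0.
  rewrite -(u2 t') -(u2 t) in H.
  move: (sqrt_prof_half t) (sqrt_prof_half t') H Lw; clear.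
  move: (Num.sqrt _) (Num.sqrt _) (L * w) => u u' x uh u'h H x0.
  by nra.
have small : 18 * (L * w) < De / 2.
  have De1 : De <= 1 by rewrite /De; lra.
  have -> : 18 * (L * w) = De / 2 * (36 * L * eta * De / S ^+ 4).
    by rewrite /w; field; rewrite gt_eqF.
  rewrite gtr_pMr ?divr_gt0// ltr_pdivrMr// mul1r (le_lt_trans _ eta2)//.
  have e0 : 0 <= eta by rewrite Eeta exprn_ge0// subr_ge0.
  by rewrite ler_piMr// !mulr_ge0// (le_trans ler01).
apply: (@le_lt_trans _ _ (C' * Num.sqrt (prof t) + 18 * (L * w))).
  apply: (@le_trans _ _ (C' * (Num.sqrt (prof t) + 18 * (L * w)))).
    by rewrite ler_wpM2l.
  rewrite mulrDr lerD2l ler_piMl//; first by rewrite mulr_ge0.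
  exact: ltW (lt_le_trans CC C1).
have H : De / 2 <= De * Num.sqrt (prof t).
  by rewrite ler_wpM2l ?sqrt_prof_half// ltW.
have -> : C * Num.sqrt (prof t) = C' * Num.sqrt (prof t) + De * Num.sqrt (prof t).
  by rewrite -mulrDl /De addrC subrK.
by rewrite ltrD2l (lt_le_trans small).
Qed.

Section Strands.
Context (R : realType) (N q p M : nat) (cc sc L : R) (Q : {poly R}).
Context (p_gt0 : (0 < p)%N) (ccsc : cc ^+ 2 + sc ^+ 2 = 1).
Context (QE : 1 - weight R p M = Q * (1 - 'X^2)).
Context (L_ge1 : 1 <= L).
Context (L_lip : forall x y : R, 0 <= x -> x <= y -> y <= 9 ->
  prof y <= prof x + L * (y - x)).
Context (M_large : (1 < p)%N ->
  let S := sin (pi / p%:R : R) in let eta := (1 - (S / 9) ^+ 2) ^+ M in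
  eta <= 100^-1 /\ 36 * L * eta < S ^+ 4).

Local Notation xF := (xF N q p M cc sc Q).
Local Notation yF := (yF N q cc sc).
Local Notation bF := (bF q cc sc).
Local Notation tF := (tF N q p M cc sc Q).

Definition sF (v l : R) : R := l * (2 + cc * cos (q%:R * v)) - sc * sin (q%:R * v).

Lemma yF_polar v l : yF (cos v) (l * sin v) = sin (N%:R * v) * sF v l.
Proof.
rewrite /yF /rF /wF /sF -!chebV_sin -!chebT_cos.
have -> : 1 - cos v ^+ 2 = sin v ^+ 2 by rewrite sin2cos2.
by ring.
Qed.

Lemma bF_polar v l :
  bF (cos v) (l * sin v) = 2 + cc * cos (q%:R * v) - l * (sc * sin (q%:R * v)).
Proof. by rewrite /bF /rF /wF -!chebV_sin -!chebT_cos; ring. Qed.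

Lemma weight_cofactor_horner x :
  Q.[x] * (1 - x ^+ 2) = 1 - (weight R p M).[x].
Proof.
have := congr1 (horner^~ x) QE.
by rewrite /= hornerM !hornerD !hornerN !hornerXn hornerC => ->.
Qed.

Lemma tF_polar v l : let W := (weight R p M).[cos (N%:R * v)] in
  tF (cos v) (l * sin v) =
  (1 - W) * sF v l ^+ 2 + W * bF (cos v) (l * sin v) ^+ 2.
Proof.
move=> W; rewrite /tF /xiF chebT_cos yF_polar exprMn sin2cos2 mulrA.
by rewrite weight_cofactor_horner.
Qed.

Lemma disk_polar (v l : R) : l ^+ 2 <= 1 -> cos v ^+ 2 + (l * sin v) ^+ 2 <= 1.
Proof.
by move=> l1; rewrite exprMn -(cos2Dsin2 v) lerD2l ler_piMl// sqr_ge0.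
Qed.

Lemma bF_polar_itv v l : l ^+ 2 <= 1 -> 1 <= bF (cos v) (l * sin v) <= 3.
Proof. by move=> l1; apply: bF_itv => //; exact: disk_polar. Qed.

Lemma sF_itv v : [/\ 1 <= sF v 1, sF v 1 <= 3, -3 <= sF v (-1), sF v (-1) <= -1 &
  1 <= 2 + cc * cos (q%:R * v)].
Proof.
have := @bF_polar_itv v 1; have := @bF_polar_itv v (-1); have := @bF_polar_itv v 0.
rewrite !bF_polar /sF expr0n sqrrN expr1n ler01 lexx.
move=> /(_ isT) /andP[h1 h2] /(_ isT) /andP[h3 h4] /(_ isT) /andP[h5 h6].
by split; lra.
Qed.

Lemma sF_sqr v l : l ^+ 2 <= 1 -> sF v l ^+ 2 <= 9.
Proof.
move=> /abs_le_sqr /andP[l1 l2]; have [h1 h2 h3 h4 h5] := sF_itv v.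
have : sF v (-1) <= sF v l by rewrite lerD2r ler_pM2r//; lra.
have : sF v l <= sF v 1 by rewrite lerD2r ler_pM2r//; lra.
by move: (sF v l) => s H1 H2; nra.
Qed.

(** The weight vanishes at the multiples of pi / p that are not multiples of pi,
    and D is a multiple of pi / p: so |sin(p theta)| = |sin(p (theta - D))|,
    which is at most p |sin(theta - D)|. Multiplying by sin(D)^2, which is at
    most 2 (sin(theta)^2 + sin(theta - D)^2), avoids a division by sin(theta). *)
Lemma weight_bound (th D : R) : pimul (p%:R * D) ->
  sin D ^+ 4 * (weight R p M).[cos th] <=
  (2 * (sin (th - D) * sin D)) ^+ 2 * (cos th ^+ 2) ^+ M.
Proof.
move=> HD; set a := sin (th - D).
have pR : 0 < p%:R :> R by rewrite ltr0n.
pose V := (chebV R p).[cos th].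
have V1 : V ^+ 2 <= p%:R ^+ 2 by apply: chebV_norm.
have V2 : V ^+ 2 * sin th ^+ 2 <= p%:R ^+ 2 * a ^+ 2.
  rewrite -exprMn chebV_sin.
  have -> : p%:R * th = p%:R * (th - D) + p%:R * D by ring.
  have [e [e1 [_ ->]]] := cos_pimul (p%:R * (th - D)) HD.
  rewrite exprMn e1 mul1r -chebV_sin exprMn ler_wpM2r ?sqr_ge0//.
  exact: chebV_norm.
have d2 : sin D ^+ 2 <= 2 * (sin th ^+ 2 + a ^+ 2).
  have -> : D = th - (th - D) by ring.
  have := cos_sqr_le1 th; have := cos_sqr_le1 (th - D); rewrite sinB /a.
  move: (cos2Dsin2 th) (cos2Dsin2 (th - D)).
  move: (cos th) (cos (th - D)) (sin th) (sin (th - D)) => x y z t e1 e2 f1 f2.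
  have : (z * y) ^+ 2 <= z ^+ 2 by rewrite exprMn ler_piMr ?sqr_ge0.
  have : (x * t) ^+ 2 <= t ^+ 2 by rewrite exprMn ler_piMl ?sqr_ge0.
  have := sqr_ge0 (z * y + x * t); nra.
have key : sin D ^+ 2 * V ^+ 2 <= 4 * (p%:R ^+ 2 * a ^+ 2).
  have H1 : sin D ^+ 2 * V ^+ 2 <= 2 * (sin th ^+ 2 + a ^+ 2) * V ^+ 2.
    by rewrite ler_wpM2r ?sqr_ge0.
  have H2 : V ^+ 2 * a ^+ 2 <= p%:R ^+ 2 * a ^+ 2 by rewrite ler_wpM2r ?sqr_ge0.
  apply: (le_trans H1); rewrite mulrDr mulrDl; lra.
have H0 : 0 <= (cos th ^+ 2) ^+ M by apply: exprn_ge0; exact: sqr_ge0.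
rewrite weightE [_ ^+ (2 * M)]exprM [leLHS]mulrA ler_wpM2r// -/V.
have -> : sin D ^+ 4 * (V ^+ 2 / p%:R ^+ 2) =
   sin D ^+ 2 * (sin D ^+ 2 * V ^+ 2) / p%:R ^+ 2 by ring.
rewrite ler_pdivrMr ?exprn_gt0//.
have -> : (2 * (a * sin D)) ^+ 2 * p%:R ^+ 2 =
   sin D ^+ 2 * (4 * (p%:R ^+ 2 * a ^+ 2)) by ring.
by rewrite ler_wpM2l ?sqr_ge0.
Qed.

(** Equal heights make the half difference D of the two angles, after a change
    of sign of one of them, a multiple of pi / p. The difference of the cosines
    is then -2 sin(M0) sin(D) with |sin D| bounded below, and the weights are
    quadratic in sin(M0). *)
Lemma strands_apart_lt v w l m : l ^+ 2 <= 1 -> m ^+ 2 <= 1 ->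
  cos (p%:R * v) = cos (p%:R * w) ->
  yF (cos v) (l * sin v) = yF (cos w) (m * sin w) ->
  0 <= cos (N%:R * v) * cos (N%:R * w) ->
  `|cos (N%:R * w)| < `|cos (N%:R * v)| ->
  `|xF (cos w) (m * sin w)| < `|xF (cos v) (l * sin v)|.
Proof.
move=> l1 m1 Ep Ey sgn lt.
have [e [e1 [He Ne]]] : exists e : R, e ^+ 2 = 1 /\
    pimul (p%:R * (v - e * w) / 2) /\ cos (N%:R * (e * w)) = cos (N%:R * w) .
  case: (cos_eqP Ep) => H.
    exists (-1); rewrite sqrrN expr1n mulN1r opprK mulrDr; split=> //; split=> //.
    by rewrite mulrN cosN.
  by exists 1; rewrite expr1n !mul1r mulrBr; split.
pose D := N%:R * (v - e * w) / 2; pose M0 := N%:R * (v + e * w) / 2.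
have HD : pimul (p%:R * D).
  by rewrite /D mulrA mulrCA -mulrA; apply: pimulMn.
have Ev : N%:R * v = M0 + D by rewrite /M0 /D; field.
have Ew : N%:R * (e * w) = M0 - D by rewrite /M0 /D; field.
have cd : cos (N%:R * v) - cos (N%:R * w) = - 2 * (sin M0 * sin D).
  by rewrite -Ne Ev Ew cosD cosB; ring.
set C := `|cos (N%:R * v)| in lt *; set C' := `|cos (N%:R * w)| in lt *.
have EC : C - C' = 2 * `|sin M0| * `|sin D|.
  have : `|C - C'| = `|cos (N%:R * v) - cos (N%:R * w)|.
    rewrite -[LHS]sqrtr_sqr -[RHS]sqrtr_sqr; congr Num.sqrt.
    have E : C * C' = cos (N%:R * v) * cos (N%:R * w).
      by rewrite /C /C' -normrM ger0_norm.
    by rewrite !sqrrB E /C /C' !real_normK ?num_real.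
  rewrite (ger0_norm (_ : 0 <= C - C')) ?subr_ge0 ?(ltW lt)// cd => ->.
  by rewrite normrM normrN (@ger0_norm _ 2)// normrM mulrA.
have D0 : sin D != 0.
  by apply/eqP => D0; move: lt; rewrite -subr_gt0 EC D0 normr0 mulr0 ltxx.
have nD : ~ pimul D by move/sin_eq0P/eqP; rewrite (negbTE D0).
have p1 : (1 < p)%N.
  rewrite ltn_neqAle p_gt0 andbT; apply/eqP => p1.
  by apply: nD; rewrite -p1 mul1r in HD.
have [eta1 eta2] := M_large p1.
set S := sin (pi / p%:R) in eta1 eta2.
have S0 : 0 < S.
  have pR : 1 < p%:R :> R by rewrite ltr1n.
  apply: sin_gt0_pi; rewrite divr_gt0 ?pi_gt0 ?(lt_trans ltr01)//=.
  by rewrite ltr_pdivrMr ?(lt_trans ltr01)// ltr_pMr ?pi_gt0.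
have Sd : S <= `|sin D|.
  rewrite -(ger0_norm (ltW S0)) -ler_sqr ?nnegrE// !real_normK ?num_real//.
  exact: sin_sqr_min.
have C2 : C ^+ 2 = cos (N%:R * v) ^+ 2 by rewrite real_normK ?num_real.
have C'2 : C' ^+ 2 = cos (N%:R * w) ^+ 2 by rewrite real_normK ?num_real.
have DD : (C - C') ^+ 2 = (2 * (sin M0 * sin D)) ^+ 2.
  by rewrite EC !exprMn !real_normK ?num_real// mulrA.
have S4 : S ^+ 4 <= sin D ^+ 4.
  rewrite (_ : 4 = 2 * 2)%N// !exprM -[X in _ <= X ^+ 2]real_normK ?num_real//.
  by do 2! (apply: lerXn2r; rewrite ?nnegrE ?sqr_ge0 ?(ltW S0)//).
have Eh : `|sin (N%:R * v)| ^+ 2 = 1 - C ^+ 2.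
  by rewrite real_normK ?num_real// C2 sin2cos2.
have S1 : S <= 1 by exact: sin_le1.
have C'0 : 0 <= C' by exact: normr_ge0.
have C1 : C <= 1 by rewrite /C ler_norml cos_geN1 cos_le1.
have l9 := sF_sqr v l1; have m9 := sF_sqr w m1.
have b9 : bF (cos w) (m * sin w) ^+ 2 <= 9.
  by have /andP[] := bF_polar_itv w m1; nra.
have Es : (1 - C ^+ 2) * sF v l ^+ 2 = (1 - C' ^+ 2) * sF w m ^+ 2.
  have := congr1 (fun y => y ^+ 2) Ey.
  by rewrite /= !yF_polar !exprMn !sin2cos2 -C2 -C'2.
rewrite /xF /xiF !chebT_cos !normrM !(ger0_norm (sqrtr_ge0 _)) -/C -/C' !tF_polar.
have [hd|hd] := leP `|sin (N%:R * v)| (S / 9).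
  apply: (@radial_gap_end R M S _ _ _ _ _ _ _ _ _ _ _
    S0 S1 erefl eta1 Sd _ hd Eh _ C'0 lt C1 EC l9 b9 _ _ Es) => //.
  - have -> : D = N%:R * v - M0 by rewrite Ev; ring.
    rewrite sinB (le_trans (ler_normB _ _))// !normrM lerD//.
      by rewrite ler_piMr// ler_norml cos_geN1 cos_le1.
    by rewrite ler_piMl// ler_norml cos_geN1 cos_le1.
  - exact: weight_ge0.
  - by rewrite C'2; exact/weight_le_exp/cos_sqr_le1.
apply: (@radial_gap_middle R M L S _ _ _ _ _ _ _ _ _ _
  L_lip L_ge1 S0 erefl _ eta2 hd Eh C'0 lt C1 l9 m9 b9 Es).
- by rewrite exprn_ile1 ?divr_ge0 ?(ltW S0)// ler_pdivrMr// mul1r (le_trans S1)// ler1n.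
- exact: weight_ge0.
- exact/weight_le1/cos_sqr_le1.
- exact: weight_ge0.
- exact/weight_le1/cos_sqr_le1.
- rewrite C2 DD; have -> : M0 = N%:R * v - D by rewrite Ev; ring.
  by apply: (le_trans _ (weight_bound _ HD)); rewrite ler_wpM2r ?weight_ge0.
- rewrite C'2 DD -Ne.
  have HD' : pimul (p%:R * - D) by rewrite mulrN; exact: pimulN.
  have := weight_bound (N%:R * (e * w)) HD'.
  have -> : N%:R * (e * w) - - D = M0 by rewrite Ew; ring.
  rewrite sinN mulrN mulrN sqrrN.
  have -> : (- sin D) ^+ 4 = sin D ^+ 4 by ring.
  by apply: le_trans; rewrite ler_wpM2r ?weight_ge0.
Qed.

Lemma strands_apart v w l m : l ^+ 2 <= 1 -> m ^+ 2 <= 1 ->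
  cos (p%:R * v) = cos (p%:R * w) ->
  yF (cos v) (l * sin v) = yF (cos w) (m * sin w) ->
  xF (cos v) (l * sin v) = xF (cos w) (m * sin w) ->
  cos (N%:R * v) = cos (N%:R * w).
Proof.
move=> l1 m1 Ep Ey Ex.
have pos X Y : 0 < Num.sqrt (prof (tF X Y)) by rewrite sqrtr_gt0 prof_gt0.
have sgn : 0 <= cos (N%:R * v) * cos (N%:R * w).
  have : 0 <= xF (cos v) (l * sin v) * xF (cos w) (m * sin w).
    by rewrite Ex -expr2 sqr_ge0.
  rewrite /xF /xiF !chebT_cos mulrACA pmulr_lge0// mulr_gt0//.
have [lt|lt|eq] := ltgtP `|cos (N%:R * w)| `|cos (N%:R * v)|.
- by have := strands_apart_lt l1 m1 Ep Ey sgn lt; rewrite Ex ltxx.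
- rewrite mulrC in sgn.
  by have := strands_apart_lt m1 l1 (esym Ep) (esym Ey) sgn lt; rewrite Ex ltxx.
move: sgn eq; move: (cos (N%:R * v)) (cos (N%:R * w)) => x y sgn E.
have /eqP : y ^+ 2 = x ^+ 2 by rewrite -[LHS]real_normK ?num_real// E real_normK ?num_real.
rewrite eqf_sqr => /orP[/eqP //|/eqP yx].
rewrite yx mulrN oppr_ge0 -expr2 in sgn.
have /eqP : x ^+ 2 = 0 by apply/eqP; rewrite eq_le sgn sqr_ge0.
by rewrite yx expf_eq0 => /eqP ->; rewrite oppr0.
Qed.

End Strands.

(** * Pairs of strands that meet *)

Lemma pimul_half_diff (R : realType) (v w : R) :
  0 <= v <= pi -> 0 <= w <= pi -> pimul ((v - w) / 2) -> v = w.
Proof.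
move=> /andP[v0 v1] /andP[w0 w1] H; have pi0 := pi_gt0 R.
by have := pimul_small H; lra.
Qed.

Lemma pimul_half_sum (R : realType) (v w : R) :
  0 <= v <= pi -> 0 <= w <= pi -> pimul ((v + w) / 2) -> v = w.
Proof.
move=> /andP[v0 v1] /andP[w0 w1] H; have pi0 := pi_gt0 R.
have [e|e] := eqVneq (v + w) (2 * pi); first by lra.
have : (v + w) / 2 < pi by rewrite ltr_pdivrMr// lt_neqAle mulrC e/=; lra.
by have := pimul_small H; lra.
Qed.

Lemma sin_half_diff (R : realType) (x y : R) : pimul ((x - y) / 2) -> sin x = sin y.
Proof.
move=> /sin_eq0P H; apply/eqP; rewrite -subr_eq0 sinB_prod H mulr0 mulr0.
exact: eqxx.
Qed.

Lemma mulr_gt0_cases (R : realType) (x y : R) : 0 < x * y ->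
  (0 < x) && (0 < y) \/ (x < 0) && (y < 0).
Proof.
have [x0|x0|->] := ltgtP x 0; last by rewrite mul0r ltxx.
- by rewrite nmulr_rgt0// => ->; right.
- by rewrite pmulr_rgt0// => ->; left.
Qed.

Section Partner.
Context (R : realType) (N q p : nat) (cc sc : R).
Context (N_gt0 : (0 < N)%N) (p_gt0 : (0 < p)%N).
Context (coNq : coprime N q) (coNp : coprime N p) (copq : coprime p q).
Context (ccsc : cc ^+ 2 + sc ^+ 2 = 1).
Context (scp : (1 < p)%N -> sc ^+ 2 < sin (pi / p%:R) ^+ 2).

Local Notation sF := (sF q cc sc).

(** These pairs of strands carry all the double points: the two strands lie at
    the same height and over the same angle up to sign. *)
Definition meet (v w : R) : Prop :=
  [/\ 0 <= v <= pi, 0 <= w <= pi, v <> w,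
      cos (p%:R * v) = cos (p%:R * w) & cos (N%:R * v) = cos (N%:R * w)].

Lemma meet_sym v w : meet v w -> meet w v.
Proof. by case=> *; split=> // /esym. Qed.

(** Equality of cosines leaves a sign for each of the frequencies p and N. Equal
    signs would give v = w since N and p are coprime, so the signs differ. *)
Lemma meet_cases v w : meet v w ->
  exists e : R, [/\ e = 1 \/ e = -1, sin (N%:R * w) = e * sin (N%:R * v),
    sin (p%:R * w) = - e * sin (p%:R * v),
    pimul (p%:R * ((v + e * w) / 2)) & pimul (N%:R * ((v - e * w) / 2))].
Proof.
case=> hv hw vw /cos_eqP Hp /cos_eqP HN.
have Em (n : nat) : (n%:R * v - n%:R * w) / 2 = n%:R * ((v - w) / 2).
  by rewrite -mulrBr mulrA.
have Ep (n : nat) : (n%:R * v + n%:R * w) / 2 = n%:R * ((v + w) / 2).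
  by rewrite -mulrDr mulrA.
have Sm (n : nat) : pimul ((n%:R * v - n%:R * w) / 2) ->
    sin (n%:R * w) = sin (n%:R * v) by move/sin_half_diff.
have Sp (n : nat) : pimul ((n%:R * v + n%:R * w) / 2) ->
    sin (n%:R * w) = - sin (n%:R * v).
  move=> H; rewrite (@sin_half_diff _ (n%:R * v) (- (n%:R * w))) ?opprK//.
  by rewrite sinN opprK.
case: Hp HN => [Hp|Hp] [HN|HN].
- rewrite !Ep in Hp HN; have := pimul_coprime coNp HN Hp.
  by move/(pimul_half_sum hv hw).
- exists 1; rewrite !mul1r mulN1r -Em -Ep; split; by [left|exact: Sm|exact: Sp|].
- exists (-1); rewrite !opprK !mulN1r !mul1r opprK -Em -Ep.
  by split; [right|exact: Sp|exact: Sm| |].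
- rewrite !Em in Hp HN; have := pimul_coprime coNp HN Hp.
  by move/(pimul_half_diff hv hw).
Qed.

Lemma meet_sin v w : meet v w -> sin (N%:R * v) != 0 /\ sin (p%:R * v) != 0.
Proof.
move=> mvw; have [e [eP _ _ Hp HN]] := meet_cases mvw.
have [hv hw vw _ _] := mvw.
have no (x : R) : x = v - e * w \/ x = v + e * w ->
    pimul (N%:R * (x / 2)) -> pimul (p%:R * (x / 2)) -> False.
  move=> xP H1 H2; have := pimul_coprime coNp H1 H2.
  case: eP xP => -> [] ->; rewrite ?mul1r ?mulN1r ?opprK.
  - by move/(pimul_half_diff hv hw).
  - by move/(pimul_half_sum hv hw).
  - by move/(pimul_half_sum hv hw).
  - by move/(pimul_half_diff hv hw).
split; apply/eqP => /sin_eq0P H0.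
- apply: (no (v + e * w)); [by right| |by []].
  have -> : N%:R * ((v + e * w) / 2) = N%:R * v - N%:R * ((v - e * w) / 2) by field.
  exact: pimulB.
- apply: (no (v - e * w)); [by left|by []|].
  have -> : p%:R * ((v - e * w) / 2) = p%:R * v - p%:R * ((v + e * w) / 2) by field.
  exact: pimulB.
Qed.

Lemma meet_open v w : meet v w -> 0 < v < pi.
Proof.
move=> mvw; have [s0 _] := meet_sin mvw; have [/andP[v0 v1] _ _ _ _] := mvw.
rewrite !lt_neqAle v0 v1 !andbT; apply/andP; split; apply/eqP => E.
  by move: s0; rewrite -E mulr0 sin0 eqxx.
move: s0; rewrite E; have /sin_eq0P -> : pimul (N%:R * pi : R).
  exact/pimulMn/pimul_pi.
by rewrite eqxx.
Qed.

(** Both partners are congruent to the same point modulo 2 pi up to sign, by the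
    congruences of [meet_cases] for p and N together. *)
Lemma meet_unique v w w' : meet v w -> meet v w' -> w = w'.
Proof.
move=> m1 m2; have [e [eP _ _ Hp HN]] := meet_cases m1.
have [e' [eP' _ _ Hp' HN']] := meet_cases m2.
have [_ hw _ _ _] := m1; have [_ hw' _ _ _] := m2.
have H1 : pimul (p%:R * ((e * w - e' * w') / 2)).
  have -> : p%:R * ((e * w - e' * w') / 2) =
    p%:R * ((v + e * w) / 2) - p%:R * ((v + e' * w') / 2) by field.
  exact: pimulB.
have H2 : pimul (N%:R * ((e * w - e' * w') / 2)).
  have -> : N%:R * ((e * w - e' * w') / 2) =
    N%:R * ((v - e' * w') / 2) - N%:R * ((v - e * w) / 2) by field.
  exact: pimulB.
have := pimul_coprime coNp H2 H1.
case: eP eP' => -> [] ->; rewrite ?mul1r ?mulN1r ?opprK.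
- exact: pimul_half_diff.
- exact: pimul_half_sum.
- rewrite -opprD mulNr => /pimulN; rewrite opprK; exact: pimul_half_sum.
- by rewrite addrC => H; apply/esym; exact: pimul_half_diff H.
Qed.

Definition grid (i : nat) : R := i%:R * pi / (N * p)%:R.

Lemma meet_grid v w : meet v w -> exists i : 'I_(N * p).+1, v = grid i.
Proof.
move=> mvw; have [e [_ _ _ [k Ek] [l El]]] := meet_cases mvw.
have /andP[v0 v1] := meet_open mvw.
have pR : 0 < p%:R :> R by rewrite ltr0n.
have NR : 0 < N%:R :> R by rewrite ltr0n.
have NpR : 0 < (N * p)%:R :> R by rewrite ltr0n muln_gt0 N_gt0.
have Ev : (N * p)%:R * v = (N%:Z * k + p%:Z * l)%:~R * pi.
  rewrite rmorphD !rmorphM /= -!pmulrn mulrDl -!mulrA -Ek -El.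
  by field.
set z := N%:Z * k + p%:Z * l in Ev.
have z0 : 0 <= z.
  by rewrite -(ler0z R) -(pmulr_lge0 _ (pi_gt0 R)) -Ev mulr_ge0 ?ltW.
have z1 : z <= (N * p)%N.
  by rewrite -(ler_int R) -(ler_pM2r (pi_gt0 R)) -Ev ler_pM2l// ltW.
have zlt : (`|z| < (N * p).+1)%N by rewrite ltnS; clear -z0 z1; lia.
exists (Ordinal zlt); rewrite /grid /=.
have -> : `|z|%N%:R = z%:~R :> R by rewrite -[in RHS](gez0_abs z0).
by rewrite -Ev mulrAC mulfV ?mul1r// gt_eqF.
Qed.

(** * Nesting *)

(** The sign, 1 or -1, that matches the orientations of the two strands along
    their common curve. *)
Definition turn (v w : R) : R := sin (N%:R * w) / sin (N%:R * v).

Lemma turnP v w : meet v w -> turn v w = 1 \/ turn v w = -1.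
Proof.
move=> mvw; have [e [eP Es _ _ _]] := meet_cases mvw; have [s0 _] := meet_sin mvw.
by rewrite /turn Es mulfK.
Qed.

Lemma turn_sin v w : meet v w -> sin (N%:R * w) = turn v w * sin (N%:R * v).
Proof. by move=> mvw; have [s0 _] := meet_sin mvw; rewrite /turn divfK. Qed.

Lemma turn_sym v w : meet v w -> turn w v = turn v w.
Proof.
move=> mvw; have -> : turn w v = (turn v w)^-1 by rewrite /turn invf_div.
by case: (turnP mvw) => ->; rewrite ?invrN1 ?invr1.
Qed.

Lemma turn_pimul v w : meet v w ->
  sin (p%:R * w) = - turn v w * sin (p%:R * v) /\
  pimul (p%:R * ((v + turn v w * w) / 2)) /\ pimul (N%:R * ((v - turn v w * w) / 2)).
Proof.
move=> mvw; have [e [eP Es Ep Hp HN]] := meet_cases mvw; have [s0 _] := meet_sin mvw.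
have -> : turn v w = e by rewrite /turn Es mulfK.
by [].
Qed.

(** The interval of signed radii of the strand w, flipped by [turn], is strictly
    included in that of v. *)
Definition inside (v w : R) : bool :=
  (turn v w * sF w (turn v w) < sF v 1) && (sF v (-1) < turn v w * sF w (- turn v w)).

(** The two end gaps are -2 sin E (cc sin P + sc cos P) and
    -2 sin E (cc sin P - sc cos P), with product 4 sin(E)^2 (sin(P)^2 - sc^2).
    Here P is a multiple of pi / p but not of pi because p and q are coprime, so
    the bound on sc makes the product positive: the gaps have the same sign, and
    one strand is nested in the other. A negative product would be a clasp. *)
Lemma gap_prod v w : meet v w ->
  0 < (sF v 1 - turn v w * sF w (turn v w)) *
      (turn v w * sF w (- turn v w) - sF v (-1)).
Proof.
move=> mvw; have [_ [Hp HN]] := turn_pimul mvw; have eP := turnP mvw.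
have [hv hw vw _ _] := mvw.
set e := turn v w in eP Hp HN *.
have e1 : e ^+ 2 = 1 by case: eP => ->; rewrite ?sqrrN expr1n.
pose W := e * w; pose P := q%:R * ((v + W) / 2); pose E := q%:R * ((v - W) / 2).
have no s : s = 1 \/ s = -1 -> ~ pimul ((v + s * W) / 2).
  rewrite /W; case: eP => -> [] ->; rewrite ?mul1r ?mulN1r ?opprK.
  - by move/(pimul_half_sum hv hw).
  - by move/(pimul_half_diff hv hw).
  - by move/(pimul_half_diff hv hw).
  - by move/(pimul_half_sum hv hw).
have nP : ~ pimul P.
  move=> HP; apply: (no 1); first by left.
  by rewrite mul1r; exact: pimul_coprime copq Hp HP.
have nE : ~ pimul E.
  move=> HE; apply: (no (-1)); first by right.
  by rewrite mulN1r; exact: pimul_coprime coNq HN HE.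
have pP : pimul (p%:R * P) by rewrite /P mulrCA; exact: pimulMn.
have p1 : (1 < p)%N.
  rewrite ltn_neqAle p_gt0 andbT; apply/eqP => p1.
  by apply: nP; move: pP; rewrite -p1 mul1r.
have sP : sc ^+ 2 < sin P ^+ 2.
  by apply: (lt_le_trans (scp p1)); exact: sin_sqr_min.
have sE : 0 < sin E ^+ 2.
  by rewrite lt_neqAle sqr_ge0 andbT eq_sym expf_eq0/=; apply/eqP => /sin_eq0P.
have cW : cos (q%:R * w) = cos (q%:R * W).
  by rewrite /W; case: eP => ->; rewrite ?mul1r// mulN1r mulrN cosN.
have sW : e * sin (q%:R * w) = sin (q%:R * W).
  by rewrite /W; case: eP => ->; rewrite ?mul1r// !mulN1r mulrN sinN.
have Ec : cos (q%:R * v) - cos (q%:R * W) = - 2 * (sin P * sin E).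
  by rewrite cosB_prod -mulrDr -mulrBr -!mulrA.
have Esn : sin (q%:R * v) - sin (q%:R * W) = 2 * (cos P * sin E).
  by rewrite sinB_prod -mulrDr -mulrBr -!mulrA.
have F1 : sF v 1 - e * sF w e = - 2 * sin E * (cc * sin P + sc * cos P).
  transitivity (cc * (cos (q%:R * v) - cos (q%:R * W)) -
    sc * (sin (q%:R * v) - sin (q%:R * W)) + (1 - e ^+ 2) * (2 + cc * cos (q%:R * w))).
    by rewrite /sF -cW -sW; ring.
  by rewrite Ec Esn e1; ring.
have F2 : e * sF w (- e) - sF v (-1) = - 2 * sin E * (cc * sin P - sc * cos P).
  transitivity (cc * (cos (q%:R * v) - cos (q%:R * W)) +
    sc * (sin (q%:R * v) - sin (q%:R * W)) + (1 - e ^+ 2) * (2 + cc * cos (q%:R * w))).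
    by rewrite /sF -cW -sW; ring.
  by rewrite Ec Esn e1; ring.
have -> : (sF v 1 - e * sF w e) * (e * sF w (- e) - sF v (-1)) =
    4 * (sin E ^+ 2 * ((cc ^+ 2 + sc ^+ 2) * sin P ^+ 2 -
       sc ^+ 2 * (cos P ^+ 2 + sin P ^+ 2))) by rewrite F1 F2; ring.
by rewrite ccsc cos2Dsin2 mul1r mulr1 mulr_gt0// mulr_gt0// subr_gt0.
Qed.

Lemma inside_total v w : meet v w -> inside v w \/ inside w v.
Proof.
move=> mvw; have := gap_prod mvw; have eP := turnP mvw; rewrite /inside (turn_sym mvw).
case: eP => ->; rewrite ?mul1r ?mulN1r ?opprK => /mulr_gt0_cases[] /andP[h1 h2].
- by left; apply/andP; split; lra.
- by right; apply/andP; split; lra.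
- by left; apply/andP; split; lra.
- by right; apply/andP; split; lra.
Qed.

Lemma inside_asym v w : meet v w -> inside v w -> ~~ inside w v.
Proof.
move=> mvw; have eP := turnP mvw; rewrite /inside (turn_sym mvw).
case: eP => ->; rewrite ?mul1r ?mulN1r ?opprK => /andP[h1 h2]; apply/negP => /andP[h3 h4].
- by lra.
- by lra.
Qed.

End Partner.

(** * From space to the sphere *)

Lemma jacobian_row_free (R : realType) n m (f : 'rV[R]_n -> 'rV[R]_m) x :
  differentiable f x -> (forall v, 'D_v f x = 0 -> v = 0) -> row_free ('J f x).
Proof.
move=> df H; apply: inj_row_free => v Hv; apply: H.
by rewrite (deriveEjacobian v df).
Qed.

Lemma rank_adds_full (R : realType) m n (A B : 'M[R]_(m, n)) :
  (forall k : 'cV_n, A *m k = 0 -> B *m k = 0 -> k = 0) ->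
  \rank (A + B)%MS = n.
Proof.
move=> H; rewrite addsmxE -mxrank_tr; apply/eqP; rewrite -/(row_free _).
apply: inj_row_free => v /(congr1 trmx).
rewrite trmx_mul trmxK trmx0 mul_col_mx -col_mx0 => /eq_col_mx [HA HB].
by rewrite -[v]trmxK (H _ HA HB) trmx0.
Qed.

Lemma sm_sqnorm (R : realType) n : sm (@sqnorm R n).
Proof. by apply: sm_sum => i; apply: sm_exp; exact: sm_coord. Qed.

Lemma sqnorm_ge0 (R : realType) n (x : 'rV[R]_n) : 0 <= sqnorm x.
Proof. by apply: sumr_ge0 => i _; exact: sqr_ge0. Qed.

Lemma sqnorm1_gt0 (R : realType) n (x : 'rV[R]_n) : 0 < sqnorm x + 1.
Proof. by rewrite ltr_wpDl ?sqnorm_ge0. Qed.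

Lemma inv_stereo_l (R : realType) (x : 'rV[R]_3) (i : 'I_3) :
  inv_stereo x 0 (lshift 1 i) = (sqnorm x + 1)^-1 * (2 * x 0 i).
Proof. by rewrite mxE (row_mxEl _ _ 0 i) mxE. Qed.

Lemma inv_stereo_r (R : realType) (x : 'rV[R]_3) (i : 'I_1) :
  inv_stereo x 0 (rshift 3 i) = (sqnorm x + 1)^-1 * (sqnorm x - 1).
Proof. by rewrite mxE (row_mxEr _ _ 0 i) mxE ord1 eqxx. Qed.

Lemma smv_inv_stereo (R : realType) : smv (@inv_stereo R).
Proof.
have Sn : sm (fun x : 'rV[R]_3 => (sqnorm x + 1)^-1).
  apply: sm_inv => [|x]; last by rewrite gt_eqF ?sqnorm1_gt0.
  by apply: sm_add; [exact: sm_sqnorm|exact: sm_const].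
move=> i; case: (@split_ordP 3 1 i) => k ->.
  rewrite (_ : (fun _ => _) = fun x => (sqnorm x + 1)^-1 * (2 * x 0 k)).
    by do 2! apply: sm_mul => //; [exact: sm_const|exact: sm_coord].
  by rewrite funeqE => x; rewrite inv_stereo_l.
rewrite (_ : (fun _ => _) = fun x => (sqnorm x + 1)^-1 * (sqnorm x - 1)).
  by apply: sm_mul => //; apply: sm_sub; [exact: sm_sqnorm|exact: sm_const].
by rewrite funeqE => x; rewrite inv_stereo_r.
Qed.

Lemma inv_stereo_sphere (R : realType) (x : 'rV[R]_3) : sqnorm (inv_stereo x) = 1.
Proof.
rewrite /sqnorm (@big_split_ord _ _ _ 3 1) /= big_ord1 inv_stereo_r.
have -> : \sum_(i < 3) inv_stereo x 0 (lshift 1 i) ^+ 2 =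
    (sqnorm x + 1) ^- 2 * (4 * sqnorm x).
  rewrite [X in 4 * X]/sqnorm !mulr_sumr; apply: eq_bigr => i _.
  by rewrite inv_stereo_l !exprMn exprVn; ring.
have := sqnorm1_gt0 x; move: (sqnorm x) => r r0.
by field; rewrite gt_eqF.
Qed.

Lemma inv_stereoK (R : realType) (x : 'rV[R]_3) (i : 'I_3) :
  x 0 i = (1 - inv_stereo x 0 (rshift 3 0))^-1 * inv_stereo x 0 (lshift 1 i).
Proof.
rewrite inv_stereo_l inv_stereo_r.
have := sqnorm1_gt0 x; move: (sqnorm x) => r r0.
have E : 1 - (r + 1)^-1 * (r - 1) = 2 / (r + 1) by field; rewrite gt_eqF.
by rewrite E; field; rewrite gt_eqF.
Qed.

Lemma inv_stereo_inj (R : realType) : injective (@inv_stereo R).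
Proof. by move=> x y E; apply/rowP => i; rewrite !inv_stereoK E. Qed.

(** The stereographic projection recovers the coordinates of x smoothly from
    those of its image, so a direction that does not move the image does not
    move x. *)
Lemma inv_stereo_free (R : realType) (x : 'rV[R]_3) : row_free ('J (@inv_stereo R) x).
Proof.
have S := smv_inv_stereo R.
apply: jacobian_row_free => [|v D0]; first exact: smv_differentiable.
apply/rowP => i; rewrite mxE.
have D j : is_derive x v (fun y => inv_stereo y 0 j) 0.
  have <- : 'D_v (fun y => inv_stereo y 0 j) x = 0.
    by rewrite -(smv_deriveE x v j S) D0 mxE.
  exact: sm_is_derive (S j).
have nz y : 1 - inv_stereo y 0 (rshift 3 0) != 0 :> R.
  rewrite inv_stereo_r; have := sqnorm1_gt0 y; move: (sqnorm y) => r r0.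
  have -> : 1 - (r + 1)^-1 * (r - 1) = 2 / (r + 1) by field; rewrite gt_eqF.
  by rewrite mulf_neq0// invr_neq0// gt_eqF.
have D1 := is_deriveB (is_derive_cst (1 : R) x v) (D (rshift 3 0)).
have DV : is_derive x v (fun y => (1 - inv_stereo y 0 (rshift 3 0))^-1) 0.
  have [de ev] : is_derive x v (fun y => 1 - inv_stereo y 0 (rshift 3 0)) (0 - 0) := D1.
  apply: DeriveDef; first exact: derivableV.
  by rewrite deriveV// ev subr0 scaler0.
have [_ E1] := is_deriveM DV (D (lshift 1 i)).
have [_ E2] := is_derive_coord x v i.
rewrite -E2; have -> : (fun y : 'rV[R]_3 => y 0 i) =
  (fun y => (1 - inv_stereo y 0 (rshift 3 0))^-1) *
  (fun y => inv_stereo y 0 (lshift 1 i)).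
  by rewrite funeqE => y; rewrite /= {1}inv_stereoK.
by rewrite E1 !scaler0 addr0.
Qed.

(** * Rotation and reflection *)

Definition turn_space (R : realType) (be s : R) (x : 'rV[R]_3) : 'rV[R]_3 :=
  \row_(i < 3) [:: cos be * x 0 0 - sin be * x 0 1;
                   sin be * x 0 0 + cos be * x 0 1; s * x 0 2%:R]`_i.

Lemma turn_spaceE (R : realType) (be s : R) (x : 'rV[R]_3) : s ^+ 2 = 1 ->
  [/\ x 0 0 = cos be * turn_space be s x 0 0 + sin be * turn_space be s x 0 1,
      x 0 1 = - sin be * turn_space be s x 0 0 + cos be * turn_space be s x 0 1 &
      x 0 2%:R = s * turn_space be s x 0 2%:R].
Proof.
move=> s1; rewrite !mxE /= mulrA -expr2 s1 mul1r.
have := cos2Dsin2 be; move: (cos be) (sin be) => c t ct.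
split=> //.
  by rewrite -[LHS]mul1r -ct; ring.
by rewrite -[LHS]mul1r -ct; ring.
Qed.

Lemma turn_space_inj (R : realType) (be s : R) : s ^+ 2 = 1 ->
  injective (turn_space be s).
Proof.
move=> s1 x y E; have [x0 x1 x2] := turn_spaceE be x s1.
have [y0 y1 y2] := turn_spaceE be y s1.
apply/rowP; apply: row3P.
- by rewrite x0 y0 E.
- by rewrite x1 y1 E.
- by rewrite x2 y2 E.
Qed.

Lemma smv_turn_space (R : realType) (be s : R) : smv (turn_space be s).
Proof.
have Sx i : sm (fun x : 'rV[R]_3 => x 0 i) by exact: sm_coord.
have Sc c : sm (fun _ : 'rV[R]_3 => c) by exact: sm_const.
apply: row3P.
- rewrite (_ : (fun _ => _) = fun x : 'rV[R]_3 => cos be * x 0 0 - sin be * x 0 1).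
    by apply: sm_sub; apply: sm_mul.
  by rewrite funeqE => x; rewrite mxE.
- rewrite (_ : (fun _ => _) = fun x : 'rV[R]_3 => sin be * x 0 0 + cos be * x 0 1).
    by apply: sm_add; apply: sm_mul.
  by rewrite funeqE => x; rewrite mxE.
- rewrite (_ : (fun _ => _) = fun x : 'rV[R]_3 => s * x 0 2%:R).
    by apply: sm_mul.
  by rewrite funeqE => x; rewrite mxE.
Qed.

Lemma turn_space_free (R : realType) (be s : R) x : s ^+ 2 = 1 ->
  row_free ('J (turn_space be s) x).
Proof.
move=> s1; have S := smv_turn_space be s.
apply: jacobian_row_free => [|v D0]; first exact: smv_differentiable.
suff E : 'D_v (turn_space be s) x = turn_space be s v.
  apply: (@turn_space_inj _ be s s1); rewrite -E D0; apply/rowP; apply: row3P;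
  by rewrite !mxE/= ?mxE !mulr0 ?subr0 ?addr0.
have Dx i := is_derive_coord x v i.
apply/rowP; apply: row3P; rewrite (smv_deriveE _ _ _ S).
- rewrite (_ : (fun _ => _) = (cos be *: (fun x : 'rV[R]_3 => x 0 0)) -
    (sin be *: (fun x : 'rV[R]_3 => x 0 1))).
    by have [_ ->] := is_deriveB (is_deriveZ (cos be) (Dx 0)) (is_deriveZ (sin be) (Dx 1));
       rewrite mxE.
  by rewrite funeqE => y; rewrite mxE.
- rewrite (_ : (fun _ => _) = (sin be *: (fun x : 'rV[R]_3 => x 0 0)) +
    (cos be *: (fun x : 'rV[R]_3 => x 0 1))).
    by have [_ ->] := is_deriveD (is_deriveZ (sin be) (Dx 0)) (is_deriveZ (cos be) (Dx 1));
       rewrite mxE.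
  by rewrite funeqE => y; rewrite mxE.
- rewrite (_ : (fun _ => _) = (s *: (fun x : 'rV[R]_3 => x 0 2%:R))).
    by have [_ ->] := is_deriveZ s (Dx 2%:R); rewrite mxE.
  by rewrite funeqE => y; rewrite mxE.
Qed.

Definition to_sphere (R : realType) (be s : R) (x : 'rV[R]_3) : 'rV[R]_4 :=
  inv_stereo (turn_space be s x).

Lemma smv_to_sphere (R : realType) (be s : R) : smv (to_sphere be s).
Proof.
by move=> i; apply: (@sm_subst _ _ _ (fun x => inv_stereo x 0 i));
   [exact: smv_inv_stereo|exact: smv_turn_space].
Qed.

Lemma to_sphere_inj (R : realType) (be s : R) : s ^+ 2 = 1 -> injective (to_sphere be s).
Proof. by move=> s1 x y /inv_stereo_inj /(turn_space_inj s1). Qed.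

Lemma to_sphere_free (R : realType) (be s : R) x : s ^+ 2 = 1 ->
  row_free ('J (to_sphere be s) x).
Proof.
move=> s1; rewrite /to_sphere jacobian_comp.
- rewrite /row_free mxrankMfree ?inv_stereo_free//.
  exact: turn_space_free.
- exact/smv_differentiable/smv_turn_space.
- exact/smv_differentiable/smv_inv_stereo.
Qed.

(** * Ribbon singularities *)

Definition pt (R : realType) (v l : R) : 'rV[R]_2 :=
  \row_(i < 2) [:: cos v; l * sin v]`_i.

Lemma sqnorm2 (R : realType) (u : 'rV[R]_2) : sqnorm u = u 0 0 ^+ 2 + u 0 1 ^+ 2.
Proof.
rewrite /sqnorm !big_ord_recl big_ord0 addr0; congr (_ + u 0 _ ^+ 2).
exact: val_inj.
Qed.

Lemma sqnorm_pt (R : realType) (v l : R) :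
  sqnorm (pt v l) = 1 - (1 - l ^+ 2) * sin v ^+ 2.
Proof.
by rewrite sqnorm2 !mxE /= exprMn cos2sin2; ring.
Qed.

Lemma disk_pt (R : realType) (u : 'rV[R]_2) : sqnorm u <= 1 ->
  exists v l, [/\ 0 <= v <= pi, l ^+ 2 <= 1 & u = pt v l].
Proof.
rewrite sqnorm2 => u1.
have X1 : u 0 0 ^+ 2 <= 1 by rewrite (le_trans _ u1)// lerDl sqr_ge0.
have [v [hv Ev]] := cos_param X1.
have Y1 : u 0 1 ^+ 2 <= sin v ^+ 2 by rewrite sin2cos2 -Ev; lra.
have [s0|s0] := eqVneq (sin v) 0.
  exists v, 0; split=> //; first by rewrite expr0n ler01.
  apply/rowP; apply: row2P; rewrite !mxE //= mul0r.
  apply/eqP; rewrite -sqrf_eq0 eq_le sqr_ge0 andbT (le_trans Y1)//.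
  by rewrite s0 expr0n.
exists v, (u 0 1 / sin v); split=> //.
  by rewrite expr_div_n ler_pdivrMr ?mul1r// lt_neqAle eq_sym sqrf_eq0 s0 sqr_ge0.
by apply/rowP; apply: row2P; rewrite !mxE //= divfK.
Qed.

Lemma pt_inj (R : realType) (v w l m : R) : 0 <= v <= pi -> 0 <= w <= pi ->
  pt v l = pt w m -> v = w /\ (sin v != 0 -> l = m).
Proof.
move=> hv hw E.
have E0 : cos v = cos w by have := congr1 (fun u : 'rV_2 => u 0 0) E; rewrite !mxE.
have vw : v = w by apply: cos_inj; rewrite ?in_itv.
split=> // s0; have := congr1 (fun u : 'rV_2 => u 0 1) E.
by rewrite !mxE /= -vw => /(mulIf s0).
Qed.

Lemma continuous_pt (R : realType) (v : R) (h : R -> R) :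
  continuous h -> continuous (fun s => pt v (h s)).
Proof.
move=> ch; rewrite (_ : (fun _ => _) =
   fun s => cos v *: delta_mx 0 0 + (h s * sin v) *: delta_mx 0 1).
  move=> s; apply: cvgD; first exact: cvg_cst.
  apply: cvgZr_tmp; apply: cvgM; [exact: ch|exact: cvg_cst].
rewrite funeqE => s; apply/rowP; apply: row2P; rewrite !mxE /=.
  by rewrite mulr1 mulr0 addr0.
by rewrite mulr0 mulr1 add0r.
Qed.

Section Ribbon.
Context (R : realType) (N q p M : nat) (cc sc L : R) (Q : {poly R}).
Context (N_gt0 : (0 < N)%N) (q_gt0 : (0 < q)%N) (p_gt0 : (0 < p)%N).
Context (coNq : coprime N q) (coNp : coprime N p) (copq : coprime p q).
Context (ccsc : cc ^+ 2 + sc ^+ 2 = 1) (scN : (1 < N)%N -> sc != 0).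
Context (scp : (1 < p)%N -> sc ^+ 2 < sin (pi / p%:R) ^+ 2).
Context (QE : 1 - weight R p M = Q * (1 - 'X^2)).
Context (L_ge1 : 1 <= L).
Context (L_lip : forall x y : R, 0 <= x -> x <= y -> y <= 9 ->
  prof y <= prof x + L * (y - x)).
Context (M_large : (1 < p)%N ->
  let S := sin (pi / p%:R : R) in let eta := (1 - (S / 9) ^+ 2) ^+ M in
  eta <= 100^-1 /\ 36 * L * eta < S ^+ 4).
Context (be sg : R) (sg1 : sg ^+ 2 = 1).

Local Notation xF := (xF N q p M cc sc Q).
Local Notation yF := (yF N q cc sc).
Local Notation bF := (bF q cc sc).
Local Notation tF := (tF N q p M cc sc Q).
Local Notation gF := (gF N q p M cc sc Q).
Local Notation sF := (sF q cc sc).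
Local Notation meet := (meet N p).
Local Notation turn := (turn N).
Local Notation inside := (inside N q cc sc).
Local Notation grid := (grid R N p).

Definition ribbon_disk (u : 'rV[R]_2) : 'rV[R]_4 := to_sphere be sg (gF u).

Local Notation f := ribbon_disk.

Lemma smv_ribbon_disk : smv f.
Proof.
by move=> i; apply: (@sm_subst _ _ _ (fun x => to_sphere be sg x 0 i));
  [exact: smv_to_sphere|exact: smv_gF].
Qed.

Lemma jacobian_ribbon_disk u : 'J f u = 'J gF u *m 'J (to_sphere be sg) (gF u).
Proof.
apply: jacobian_comp.
  exact: smv_differentiable (smv_gF N q p M cc sc Q) u.
exact: smv_differentiable (smv_to_sphere be sg) (gF u).
Qed.

Lemma ribbon_disk_immersion : disk_immersion f.
Proof.
split; first exact/smv_smooth/smv_ribbon_disk.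
  by move=> _ [u _ <-]; exact: inv_stereo_sphere.
move=> u; rewrite inE /disk /= sqnorm2 => u1.
rewrite jacobian_ribbon_disk mxrankMfree; last exact: to_sphere_free.
apply/eqP; rewrite -/(row_free _); apply: jacobian_row_free.
  exact: smv_differentiable (smv_gF N q p M cc sc Q) u.
by move=> v; apply: gF_immersion.
Qed.

Lemma gF_pt v l : [/\ gF (pt v l) 0 0 = xF (cos v) (l * sin v),
  gF (pt v l) 0 1 = yF (cos v) (l * sin v) & gF (pt v l) 0 2%:R = cos (p%:R * v)].
Proof. by rewrite /zF !mxE /= /zF chebT_cos. Qed.

Lemma sF_lt v l m : (sF v l < sF v m) = (l < m).
Proof.
have [_ _ _ _ r1] := sF_itv q ccsc v.
by rewrite ltrD2r ltr_pM2r// (lt_le_trans ltr01).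
Qed.

Lemma sF_inj v l m : sF v l = sF v m -> l = m.
Proof.
move=> E; apply/eqP; rewrite eq_le !leNgt.
by rewrite -(sF_lt v m l) -(sF_lt v l m) E ltxx.
Qed.

(** The signed radius is a coordinate of the strand, except when sin theta = 0;
    then the abscissa is [bF] up to sign, and it is injective because sc and
    sin(q v) are not 0. *)
Lemma strand_embedded v l m : 0 <= v <= pi -> l ^+ 2 <= 1 -> m ^+ 2 <= 1 ->
  xF (cos v) (l * sin v) = xF (cos v) (m * sin v) ->
  yF (cos v) (l * sin v) = yF (cos v) (m * sin v) -> pt v l = pt v m.
Proof.
move=> hv l1 m1 Ex; rewrite !yF_polar => Ey.
suff [s0|->] : sin v = 0 \/ l = m by [apply/rowP; apply: row2P; rewrite !mxE /= ?s0 ?mulr0|].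
have [s0|s0] := eqVneq (sin v) 0; [by left|right].
have [sN|sN] := eqVneq (sin (N%:R * v)) 0; last first.
  by move/(mulfI sN): Ey; exact: sF_inj.
have N1 : (1 < N)%N.
  rewrite ltn_neqAle N_gt0 andbT; apply/eqP => N1.
  by move: s0; rewrite -[v]mul1r -[1]/(1%:R) N1 sN eqxx.
have sq : sin (q%:R * v) != 0.
  apply/eqP => /sin_eq0P Hq; move/sin_eq0P: sN => HN.
  by have /sin_eq0P/eqP := pimul_coprime coNq HN Hq; rewrite (negbTE s0).
have c1 : cos (N%:R * v) ^+ 2 = 1 by rewrite cos2sin2 sN expr0n subr0.
have sb k : k ^+ 2 <= 1 -> xF (cos v) (k * sin v) =
    cos (N%:R * v) * bF (cos v) (k * sin v).
  move=> k1; have /andP[b1 _] := bF_polar_itv q ccsc v k1.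
  rewrite /xF /xiF chebT_cos (tF_polar _ _ _ _ QE) weight_end// subrr mul0r add0r mul1r.
  rewrite prof_id ?exprn_ege1// sqrtr_sqr ger0_norm// (le_trans ler01)//.
have c0 : cos (N%:R * v) != 0 by rewrite -sqrf_eq0 c1 oner_eq0.
move: Ex; rewrite !sb// => /(mulfI c0).
rewrite !bF_polar => /addrI /oppr_inj /mulIf; apply.
by rewrite mulf_neq0// scN.
Qed.

Lemma meet_sF v w l m : meet v w ->
  yF (cos v) (l * sin v) = yF (cos w) (m * sin w) <-> sF v l = turn v w * sF w m.
Proof.
move=> mvw; have [s0 _] := meet_sin coNp mvw.
rewrite !yF_polar (turn_sin coNp mvw) mulrAC [_ * sin _]mulrC; split=> [|->//].
exact: (mulfI s0).
Qed.

(** The angle N v is a multiple of pi / p but not of pi, that is an interior root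
    of V_p. *)
Lemma meet_flat v w : meet v w ->
  (cos (N%:R * v)) ^+ 2 <= 1 /\ (chebV R p).[cos (N%:R * v)] = 0.
Proof.
move=> mvw; split; first exact: cos_sqr_le1.
have [s0 _] := meet_sin coNp mvw; have [_ [Hp HN]] := turn_pimul coNp mvw.
apply/(mulIf s0); rewrite mul0r chebV_sin; apply/sin_eq0P.
have -> : p%:R * (N%:R * v) = N%:R * (p%:R * ((v + turn v w * w) / 2)) +
   p%:R * (N%:R * ((v - turn v w * w) / 2)) by field.
by apply: pimulD; exact: pimulMn.
Qed.

(** On such strands the weight is 0, so the point depends only on the angle and
    on y: both strands are parts of one curve. *)
Lemma meet_image v w l m : meet v w -> sF v l = turn v w * sF w m ->
  gF (pt v l) = gF (pt w m).
Proof.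
move=> mvw; have Ey := (meet_sF l m mvw).2; move=> /Ey {}Ey.
have [c1 V0] := meet_flat mvw.
have [_ _ _ Ep EN] := mvw.
have [v0 v1 v2] := gF_pt v l; have [w0 w1 w2] := gF_pt w m.
apply/rowP; apply: row3P; last by rewrite v2 w2.
  rewrite v0 w0 /xF !(tF_flat _ _ _ QE) /xiF !chebT_cos -?EN//.
  by rewrite Ey.
by rewrite v1 w1.
Qed.

Lemma double_points v w l m : 0 <= v <= pi -> 0 <= w <= pi ->
  l ^+ 2 <= 1 -> m ^+ 2 <= 1 -> pt v l <> pt w m -> gF (pt v l) = gF (pt w m) ->
  meet v w /\ sF v l = turn v w * sF w m.
Proof.
move=> hv hw l1 m1 ne E.
have [v0 v1 v2] := gF_pt v l; have [w0 w1 w2] := gF_pt w m.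
rewrite E w0 in v0; rewrite E w1 in v1; rewrite E w2 in v2.
have EN : cos (N%:R * v) = cos (N%:R * w).
  exact: (strands_apart p_gt0 ccsc QE L_ge1 L_lip M_large l1 m1
    (esym v2) (esym v1) (esym v0)).
have mvw : meet v w.
  split=> // vw; apply: ne; rewrite -vw in v0 v1 *.
  exact: strand_embedded hv l1 m1 (esym v0) (esym v1).
by split=> //; apply/(meet_sF l m mvw).
Qed.

(** One arc for each ordered pair, the strand that passes through coming second;
    all the strands concerned lie on the grid of multiples of pi / (N p). *)
Definition ribbon_pair (ij : 'I_(N * p).+1 * 'I_(N * p).+1) : bool :=
  let v := grid ij.1 in let w := grid ij.2 in
  [&& v != w, cos (p%:R * v) == cos (p%:R * w),
      cos (N%:R * v) == cos (N%:R * w) & inside v w].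

Lemma grid_itv (i : 'I_(N * p).+1) : 0 <= grid i <= pi.
Proof.
have NpR : 0 < (N * p)%:R :> R by rewrite ltr0n muln_gt0 N_gt0.
rewrite /grid divr_ge0 ?mulr_ge0 ?pi_ge0 ?(ltW NpR)//= ler_pdivrMr// mulrC.
by rewrite ler_pM2l ?pi_gt0// ler_nat -ltnS.
Qed.

Lemma grid_inj : injective (fun i : 'I_(N * p).+1 => grid i).
Proof.
move=> i j; have NpR : (N * p)%:R^-1 != 0 :> R.
  by rewrite invr_neq0// pnatr_eq0 -lt0n muln_gt0 N_gt0.
move/(mulIf NpR)/(mulIf (lt0r_neq0 (pi_gt0 R)))/eqP; rewrite eqr_nat => /eqP.
exact: val_inj.
Qed.

Lemma ribbon_pairP ij : ribbon_pair ij <->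
  meet (grid ij.1) (grid ij.2) /\ inside (grid ij.1) (grid ij.2).
Proof.
split=> [/and4P[/eqP h1 /eqP h2 /eqP h3 h4]|[[_ _ h1 h2 h3] h4]].
  by split=> //; split=> //; exact: grid_itv.
by apply/and4P; split=> //; apply/eqP.
Qed.

Definition npairs : nat := #|[set ij | ribbon_pair ij]|.
Definition outer (k : 'I_npairs) : R := grid (enum_val k).1.
Definition inner (k : 'I_npairs) : R := grid (enum_val k).2.

Lemma pairP k : meet (outer k) (inner k) /\ inside (outer k) (inner k).
Proof. by apply/ribbon_pairP; have := enum_valP k; rewrite inE. Qed.

Lemma pair_inj k k' : outer k = outer k' -> inner k = inner k' -> k = k'.
Proof.
move=> /grid_inj h1 /grid_inj h2; apply: enum_val_inj.
by rewrite [LHS]surjective_pairing [RHS]surjective_pairing h1 h2.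
Qed.

Lemma pair_exists v w : meet v w -> inside v w ->
  exists k, outer k = v /\ inner k = w.
Proof.
move=> mvw ivw.
have [i Ei] := meet_grid N_gt0 p_gt0 coNp mvw.
have [j Ej] := meet_grid N_gt0 p_gt0 coNp (meet_sym mvw).
have H : (i, j) \in [set ij | ribbon_pair ij].
  by rewrite inE; apply/ribbon_pairP; rewrite /= -Ei -Ej.
by exists (enum_rank_in H (i, j)); rewrite /outer /inner enum_rankK_in// -Ei -Ej.
Qed.

Lemma outer_inj k k' : outer k = outer k' -> k = k'.
Proof.
move=> E; apply: pair_inj => //; have [m1 _] := pairP k; have [m2 _] := pairP k'.
by apply: (meet_unique coNp m1); rewrite E.
Qed.

Lemma inner_inj k k' : inner k = inner k' -> k = k'.
Proof.
move=> E; apply: pair_inj => //; have [m1 _] := pairP k; have [m2 _] := pairP k'.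
by apply: (meet_unique coNp (meet_sym m1)); rewrite E; exact: meet_sym.
Qed.

(** Partners are unique, so otherwise the two strands of one pair would be nested
    in each other. *)
Lemma outer_inner k k' : outer k <> inner k'.
Proof.
move=> E; have [m1 i1] := pairP k; have [m2 i2] := pairP k'.
have E2 : inner k = outer k'.
  by apply: (meet_unique coNp m1); rewrite E; exact: meet_sym.
have := inside_asym coNp m1 i1; rewrite E E2.
by rewrite i2.
Qed.

(** The position on the strand v of the point of the strand w at position m: the
    signed radius is affine in the position, so the equation is solved by a
    division. *)
Definition level (v w m : R) : R :=
  (turn v w * sF w m + sc * sin (q%:R * v)) / (2 + cc * cos (q%:R * v)).

Lemma level_sF v w m : sF v (level v w m) = turn v w * sF w m.
Proof.
have [_ _ _ _ r1] := sF_itv q ccsc v.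
rewrite /sF /level divfK ?addrK// gt_eqF// (lt_le_trans ltr01)//.
Qed.

Lemma level_open v w m : meet v w -> inside v w -> m ^+ 2 <= 1 ->
  -1 < level v w m < 1.
Proof.
move=> mvw /andP[i1 i2] /abs_le_sqr /andP[m1 m2].
rewrite -(sF_lt v (-1)) -(sF_lt v _ 1) level_sF.
have [_ _ _ _ r1] := sF_itv q ccsc w.
have mono a b : a <= b -> sF w a <= sF w b.
  by move=> ab; rewrite lerD2r ler_pM2r// (lt_le_trans ltr01).
have h1 := mono _ _ m1; have h2 := mono _ _ m2.
case: (turnP coNp mvw) i1 i2 => ->; rewrite ?opprK => i1 i2.
  by apply/andP; split; lra.
by apply/andP; split; lra.
Qed.

(** The inner strand is a whole chord X = constant of the disk, hence properly
    embedded, and the matching part of the outer strand is a segment in the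
    interior. *)
Definition arc_in (k : 'I_npairs) (s : R) : 'rV[R]_2 :=
  pt (outer k) (level (outer k) (inner k) (2 * s - 1)).
Definition arc_thru (k : 'I_npairs) (s : R) : 'rV[R]_2 := pt (inner k) (2 * s - 1).

Lemma continuous_affine (a b : R) : continuous (fun s : R => a * s + b).
Proof.
move=> s; apply: cvgD; last exact: cvg_cst.
by apply: cvgM; [exact: cvg_cst|exact: cvg_id].
Qed.

Lemma ribbon_disk_singularities : ribbon_singularities f arc_in arc_thru.
Proof.
have unit_sqr (s : R) : s \in `[0, 1] -> (2 * s - 1) ^+ 2 <= 1.
  by rewrite in_itv/= => /andP[s0 s1]; nra.
have sin_outer k : sin (outer k) != 0.
  have [m1 _] := pairP k; have [s0 _] := meet_sin coNp m1.
  apply/eqP => /sin_eq0P /(pimulMn N) /sin_eq0P/eqP; by rewrite (negbTE s0).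
have sin_inner k : sin (inner k) != 0.
  have [m1 _] := pairP k; have [s0 _] := meet_sin coNp (meet_sym m1).
  apply/eqP => /sin_eq0P /(pimulMn N) /sin_eq0P/eqP; by rewrite (negbTE s0).
have itv_outer k : 0 <= outer k <= pi by exact: grid_itv.
have itv_inner k : 0 <= inner k <= pi by exact: grid_itv.
have open_pt v l : sin v != 0 -> l ^+ 2 < 1 -> open_disk (pt v l).
  move=> s0 l1; rewrite /open_disk /= sqnorm_pt ltrBlDr ltrDl mulr_gt0 ?subr_gt0//.
  by rewrite lt_neqAle eq_sym sqrf_eq0 s0 sqr_ge0.
have E_gF : forall x y, f x = f y -> gF x = gF y by move=> x y /to_sphere_inj; apply.
split.
- move=> k; split; apply: continuous_subspaceT; apply: continuous_pt.
    rewrite (_ : (fun _ => _) = fun s =>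
      turn (outer k) (inner k) * 2 * (2 + cc * cos (q%:R * inner k)) /
        (2 + cc * cos (q%:R * outer k)) * s +
      level (outer k) (inner k) (-1)); first exact: continuous_affine.
    by rewrite funeqE => s; rewrite /level /sF; ring.
  exact: continuous_affine.
- move=> k s hs; have [m1 i1] := pairP k; apply: open_pt => //.
  have /andP[h1 h2] := level_open m1 i1 (unit_sqr s hs); nra.
- move=> k; split; rewrite /circle /= sqnorm_pt.
    by rewrite mulr0 sub0r sqrrN expr1n subrr mul0r subr0.
  by rewrite mulr1 (_ : 2 - 1 = 1) ?expr1n ?subrr ?mul0r ?subr0//; lra.
- by move=> k s; rewrite in_itv/= => /andP[s0 s1]; apply: open_pt => //; nra.
- move=> k k' s t hs ht /(pt_inj (itv_outer k) (itv_outer k')) [/outer_inj kk El].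
  subst k'; split=> //; have {}El := El (sin_outer k).
  have := congr1 (sF (outer k)) El; rewrite !level_sF => E.
  have [m1 _] := pairP k.
  have t0 : turn (outer k) (inner k) != 0.
    by case: (turnP coNp m1) => ->; rewrite ?oppr_eq0 oner_eq0.
  by have := sF_inj (mulfI t0 E); lra.
- move=> k k' s t hs ht /(pt_inj (itv_inner k) (itv_inner k')) [/inner_inj kk El].
  by subst k'; split=> //; have := El (sin_inner k); lra.
- move=> k k' s t hs ht /(pt_inj (itv_outer k) (itv_inner k')) [E _].
  exact: outer_inner E.
- move=> k s hs; have [m1 _] := pairP k; congr (to_sphere be sg _).
  by apply: meet_image => //; exact: level_sF.
- move=> x y; rewrite !inE /disk /= => /disk_pt[v [l [hv l1 ->]]].
  move=> /disk_pt[w [m [hw m1 ->]]] ne /E_gF /(double_points hv hw l1 m1 ne) [mvw Es].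
  have half (r : R) : r ^+ 2 <= 1 -> (r + 1) / 2 \in `[0, 1] /\ 2 * ((r + 1) / 2) - 1 = r.
    move=> /abs_le_sqr /andP[r0 r1]; rewrite in_itv/=; split; last by field.
    by apply/andP; split; lra.
  have [ivw|iwv] := inside_total p_gt0 coNq coNp copq ccsc scp mvw.
    have [k [Ev Ew]] := pair_exists mvw ivw; have [h1 h2] := half m m1.
    exists k, ((m + 1) / 2); split=> //; left; rewrite /arc_in /arc_thru Ev Ew h2.
    split=> //; congr pt; apply: (@sF_inj v); by rewrite level_sF.
  have [k [Ew Ev]] := pair_exists (meet_sym mvw) iwv; have [h1 h2] := half l l1.
  exists k, ((l + 1) / 2); split=> //; right; rewrite /arc_in /arc_thru Ev Ew h2.
  split=> //; congr pt; apply: (@sF_inj w); rewrite level_sF (turn_sym coNp mvw) Es.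
  by case: (turnP coNp mvw) => ->; rewrite ?mul1r// !mulN1r opprK.
- move=> k s hs; have [mvw ivw] := pairP k.
  set v := outer k in mvw ivw *; set w := inner k in mvw ivw *.
  rewrite !jacobian_ribbon_disk.
  have Eg : gF (arc_in k s) = gF (arc_thru k s).
    by apply: meet_image => //; exact: level_sF.
  rewrite -Eg -addsmxMr mxrankMfree; last exact: to_sphere_free.
  have [Sv Pv] := meet_sin coNp mvw.
  have [Sw Pw] := meet_sin coNp (meet_sym mvw).
  have [c1 V0] := meet_flat mvw.
  apply: rank_adds_full => c J1 J2.
  have X1 : arc_in k s 0 0 = cos v by rewrite mxE.
  have X2 : arc_thru k s 0 0 = cos w by rewrite mxE.
  have [_ _ _ _ EN] := mvw.
  apply: (gF_transverse N_gt0 p_gt0 ccsc QE _ _ _ _ _ _ J1 J2).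
  + by rewrite X1 cos_sqr_le1.
  + by rewrite X1 X2 /xiF !chebT_cos.
  + by have := congr1 (fun x : 'rV_3 => x 0 1) Eg; rewrite !mxE.
  + by rewrite X1 /xiF chebT_cos.
  + by rewrite X1; apply/eqP => V; move: Sv; rewrite -chebV_sin V mul0r eqxx.
  rewrite X1 X2; apply/eqP => E.
  have [Ep _] := turn_pimul coNp mvw.
  have : sin (N%:R * v) * sin (p%:R * w) = sin (N%:R * w) * sin (p%:R * v).
    rewrite -!chebV_sin.
    transitivity ((chebV R N).[cos v] * (chebV R p).[cos w] * sin v * sin w); first by ring.
    by rewrite E; ring.
  rewrite Ep (turn_sin coNp mvw) => E2.
  have : 2 * (turn v w * (sin (N%:R * v) * sin (p%:R * v))) == 0.
    by rewrite -subr_eq0 subr0; apply/eqP; lra.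
  have t0 : turn v w != 0.
    by case: (turnP coNp mvw) => ->; rewrite ?oppr_eq0 oner_eq0.
  apply/negP; apply: mulf_neq0; first by rewrite pnatr_eq0.
  by rewrite (mulf_neq0 t0 (mulf_neq0 Sv Pv)).
Qed.

End Ribbon.

(** * The knot as the boundary *)

Lemma cos_half_diff (R : realType) (x y : R) : pimul ((x - y) / 2) -> cos x = cos y.
Proof.
move=> /sin_eq0P H; apply/eqP; rewrite -subr_eq0 cosB_prod H mulr0 mulr0.
exact: eqxx.
Qed.

Lemma mod_2pi (R : realType) (t : R) :
  exists t' : R, [/\ 0 <= t', t' < 2 * pi & pimul ((t - t') / 2)].
Proof.
have pi2 : 0 < 2 * pi :> R by rewrite mulr_gt0// pi_gt0.
pose k := Num.floor (t / (2 * pi)).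
have := floor_itv (t / (2 * pi)); rewrite -/k => /andP[].
rewrite ler_pdivlMr// ltr_pdivrMr// rmorphD /= mulrDl mul1r => h1 h2.
exists (t - k%:~R * (2 * pi)); split; [lra|lra|].
exists k; rewrite opprB addrC subrK mulrCA mulrAC divff ?mul1r//.
Qed.

Lemma pimul_scale (R : realType) (n : nat) (a t t' : R) : pimul ((t - t') / 2) ->
  pimul ((n%:R * (t + a) - n%:R * (t' + a)) / 2).
Proof.
move=> H; have -> : (n%:R * (t + a) - n%:R * (t' + a)) / 2 = n%:R * ((t - t') / 2).
  by field.
exact: pimulMn.
Qed.

Lemma lissajous_periodic (R : realType) (N q p : nat) (phi t t' : R) :
  pimul ((t - t') / 2) -> lissajous_toric N q p phi t = lissajous_toric N q p phi t'.
Proof.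
move=> H; have HN := pimul_scale N 0 H; have Hq := pimul_scale q 0 H.
have Hp := pimul_scale p phi H; rewrite !addr0 in HN Hq.
by rewrite /lissajous_toric (cos_half_diff HN) (sin_half_diff HN) (sin_half_diff Hq)
  (cos_half_diff Hp).
Qed.

Lemma circle_pt (R : realType) (u : 'rV[R]_2) :
  circle u <-> exists v, u = pt v 1.
Proof.
split=> [|[v ->]]; last by rewrite /circle /= sqnorm_pt expr1n subrr mul0r subr0.
rewrite /circle /= => u1; have [|v [l [_ _ Eu]]] := @disk_pt _ u; first by rewrite u1.
subst u; move/eqP: u1; rewrite sqnorm_pt -subr_eq0 addrAC subrr sub0r oppr_eq0.
rewrite mulf_eq0 sqrf_eq0 subr_eq0 eq_sym => /orP[|/eqP s0]; last first.
  by exists v; apply/rowP; apply: row2P; rewrite !mxE //= s0 !mulr0.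
rewrite sqrf_eq1 => /orP[] /eqP ->; first by exists v.
by exists (- v); apply/rowP; apply: row2P; rewrite !mxE /= ?cosN// sinN mul1r mulN1r.
Qed.

(** The shift by t1 turns the height into cos(p v) up to sign, which is even in
    v; the radius becomes 2 + cos(q v + c), and the angle is rotated by N t1. *)
Lemma boundary_lissajous (R : realType) (N q p M : nat) (Q : {poly R})
    (phi t1 : R) (j : int) (e : R) (v : R) :
  let c := q%:R * t1 - pi / 2 in
  (0 < p)%N -> 1 - weight R p M = Q * (1 - 'X^2) ->
  p%:R * (t1 + phi) = j%:~R * pi -> e ^+ 2 = 1 ->
  (forall x : R, cos (x + j%:~R * pi) = e * cos x) ->
  ribbon_disk N q p M (cos c) (sin c) Q (N%:R * t1) e (pt v 1) =
  inv_stereo (lissajous_toric N q p phi (v + t1)).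
Proof.
move=> c p0 QE Ej e1 He; congr inv_stereo.
have [g0 g1 g2] := gF_pt N q p M (cos c) (sin c) Q v 1.
pose b := bF q (cos c) (sin c) (cos v) (1 * sin v).
have Es : sF q (cos c) (sin c) v 1 = b.
  by rewrite /b bF_polar /sF !mul1r; ring.
have Eb : b = 2 + sin (q%:R * (v + t1)).
  have -> : sin (q%:R * (v + t1)) = cos (q%:R * v + c).
    by rewrite -cosBpihalf mulrDr addrA.
  by rewrite /b bF_polar (cosD (q%:R * v) c); ring.
have bb : 1 <= b.
  have l1 : (1 : R) ^+ 2 <= 1 by rewrite expr1n.
  by have /andP[] := bF_polar_itv q (cos2Dsin2 c) v l1.
have Ex : gF N q p M (cos c) (sin c) Q (pt v 1) 0 0 = cos (N%:R * v) * b.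
  rewrite g0 /xF /xiF chebT_cos (tF_polar _ _ _ _ QE) Es -/b.
  rewrite -mulrDl subrK mul1r prof_id ?exprn_ege1// sqrtr_sqr ger0_norm//.
  by rewrite (le_trans ler01).
have Ey : gF N q p M (cos c) (sin c) Q (pt v 1) 0 1 = sin (N%:R * v) * b.
  by rewrite g1 yF_polar Es.
apply/rowP; apply: row3P; rewrite [LHS]mxE [RHS]mxE /= ?Ex ?Ey ?g2.
- by rewrite -Eb [N%:R * (v + t1)]mulrDr (cosD (N%:R * v)); ring.
- by rewrite -Eb [N%:R * (v + t1)]mulrDr (sinD (N%:R * v)); ring.
- by rewrite -He -Ej; congr cos; ring.
Qed.

(** If sin c = 0, the radius is even in v as well as the height, and the knot
    passes through the same point at v = pi / N and v = - pi / N. *)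
Lemma phase_nondegenerate (R : realType) (N q p : nat) (phi t1 : R) (j : int) :
  (1 < N)%N -> p%:R * (t1 + phi) = j%:~R * pi ->
  ~ critical_phase N q p phi -> sin (q%:R * t1 - pi / 2) != 0.
Proof.
move=> N1 Ej /contrapT [inj _]; apply/eqP => s0.
have pi0 := pi_gt0 R; have pi0' := pi_ge0 R.
have NR : 1 < N%:R :> R by rewrite ltr1n.
have N0 : 0 < N%:R :> R by rewrite (lt_trans ltr01).
pose v := pi / N%:R : R.
have Nv : N%:R * v = pi by rewrite /v mulrC divfK// gt_eqF.
have E : lissajous_toric N q p phi (v + t1) = lissajous_toric N q p phi (- v + t1).
  have HN : pimul ((N%:R * (v + t1) - N%:R * (- v + t1)) / 2).
    have -> : (N%:R * (v + t1) - N%:R * (- v + t1)) / 2 = N%:R * v by field.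
    by rewrite Nv; exact: pimul_pi.
  have Eq : sin (q%:R * (v + t1)) = sin (q%:R * (- v + t1)).
    have S x : sin (q%:R * (x + t1)) = cos (q%:R * x) * cos (q%:R * t1 - pi / 2).
      rewrite -cosBpihalf mulrDr -addrA (cosD (q%:R * x)) s0 mulr0 subr0.
      by [].
    by rewrite !S mulrN cosN.
  have Ep : cos (p%:R * (v + t1 + phi)) = cos (p%:R * (- v + t1 + phi)).
    rewrite -[RHS]cosN; apply: cos_half_diff; exists j.
    by rewrite -Ej; field.
  by rewrite /lissajous_toric (cos_half_diff HN) (sin_half_diff HN) Eq Ep.
have [ta [ta0 ta1 Ha]] := mod_2pi (v + t1).
have [tb [tb0 tb1 Hb]] := mod_2pi (- v + t1).
have tab : ta = tb.
  apply: inj; rewrite ?in_itv/= ?ta0 ?tb0//.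
  by rewrite -(lissajous_periodic N q p phi Ha) -(lissajous_periodic N q p phi Hb).
have : pimul v.
  have -> : v = (v + t1 - ta) / 2 - (- v + t1 - tb) / 2 by rewrite tab; field.
  exact: pimulB.
have v0 : 0 < v by rewrite divr_gt0.
have v1 : v < pi by rewrite ltr_pdivrMr// ltr_pMr.
by move/pimul_small; rewrite v1 (lt_trans _ v0) ?oppr_lt0// => /(_ isT) v00; move: v0; rewrite v00 ltxx.
Qed.

(** For p = 1 no two strands meet and any exponent will do. *)
Lemma large_exponent (R : realType) (p : nat) (L : R) : 1 <= L ->
  exists M : nat, (1 < p)%N ->
  let S := sin (pi / p%:R : R) in let eta := (1 - (S / 9) ^+ 2) ^+ M in
  eta <= 100^-1 /\ 36 * L * eta < S ^+ 4.
Proof.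
move=> L1; have [p1|p1] := leqP p 1; first by exists 0%N.
set S := sin (pi / p%:R : R).
have pR : 1 < p%:R :> R by rewrite ltr1n.
have pR0 : 0 < p%:R :> R by rewrite (lt_trans ltr01).
have S0 : 0 < S.
  apply: sin_gt0_pi; rewrite divr_gt0 ?pi_gt0//=.
  by rewrite ltr_pdivrMr// ltr_pMr ?pi_gt0.
have S1 : S <= 1 by exact: sin_le1.
have x1 : `|1 - (S / 9) ^+ 2| < 1.
  have h0 : 0 < (S / 9) ^+ 2 by rewrite exprn_gt0// divr_gt0.
  have h1 : (S / 9) ^+ 2 <= 1 by rewrite exprn_ile1//; lra.
  by rewrite ger0_norm; lra.
have S4 : 0 < S ^+ 4 by rewrite exprn_gt0.
have L0 : 0 < 36 * L by lra.
have e0 : 0 < Num.min 100^-1 (S ^+ 4 / (36 * L)).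
  by rewrite lt_min invr_gt0 ltr0n/= divr_gt0.
have /cvgr0Pnorm_lt/(_ _ e0) [M _ HM] := cvg_expr x1.
exists M => _ eta; have := HM M (leqnn M).
rewrite /= -/eta => H; have := le_lt_trans (ler_norm _) H.
rewrite lt_min => /andP[h1 h2]; split; first exact: ltW.
by rewrite mulrC -ltr_pdivlMr.
Qed.

Theorem theorem1 (R : realType) (N q p : nat)
  (N_gt0 : (0 < N)%N) (q_gt0 : (0 < q)%N) (p_gt0 : (0 < p)%N)
  (coNq : coprime N q) (coNp : coprime N p) (copq : coprime p q)
  (phi : R) (phi_noncritical : ~ critical_phase N q p phi) :
  ribbon (knotK N q p phi).
Proof.
pose beta := - (q%:R * phi) - pi / 2.
have [j Hj] : exists j : int, (1 < p)%N ->
    sin (q%:R * (j%:~R * pi / p%:R) + beta) ^+ 2 < sin (pi / p%:R) ^+ 2.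
  have [p1|p1] := leqP p 1; first by exists 0.
  by have [j Hj] := small_phase beta p1 copq; exists j.
pose t1 := j%:~R * pi / p%:R - phi.
have Ej : p%:R * (t1 + phi) = j%:~R * pi.
  by rewrite /t1 subrK mulrC divfK// pnatr_eq0 -lt0n.
pose c := q%:R * t1 - pi / 2.
have Ec : q%:R * (j%:~R * pi / p%:R) + beta = c.
  by rewrite /c /t1 /beta mulrBr addrA.
rewrite Ec in Hj.
have scN N1 : sin c != 0 := phase_nondegenerate N1 Ej phi_noncritical.
have Hpi : pimul (j%:~R * pi : R) by exists j.
have [e [e1 [He0 _]]] := cos_pimul 0 Hpi; rewrite add0r cos0 mulr1 in He0.
have He (x : R) : cos (x + j%:~R * pi) = e * cos x.
  have /sin_eq0P s0 := Hpi.
  by rewrite cosD s0 mulr0 subr0 He0 mulrC.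
have [L L1 HL] := prof_lipschitz (ler0n R 9).
have [M HM] := large_exponent p L1.
have [Q QE] := weight_cofactor R M p_gt0.
exists (ribbon_disk N q p M (cos c) (sin c) Q (N%:R * t1) e); split.
- by apply: ribbon_disk_immersion => //; exact: cos2Dsin2.
- do 3! eexists.
  by apply: (@ribbon_disk_singularities _ _ _ _ _ _ _ L) => //; exact: cos2Dsin2.
apply/seteqP; split=> [_ [u /circle_pt [v ->] <-]|_ [t _ <-]].
  rewrite (boundary_lissajous N q v p_gt0 QE Ej e1 He).
  have [t [t0 t2 Ht]] := mod_2pi (v + t1); exists t.
    by rewrite /= in_itv/= t0 ltW.
  by rewrite /= (lissajous_periodic N q p phi Ht).
exists (pt (t - t1) 1); first by apply/circle_pt; exists (t - t1).
by rewrite (boundary_lissajous N q (t - t1) p_gt0 QE Ej e1 He) subrK.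
Qed.
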